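(* Let $R$ and $\hat R$ be $\mathscr{R}$-cross-sections of $\mathcal{O}_n$, associated with decreasing trees $(\overline{n},\prec_1)$ (with root $\mathbf{r}_1$) and $(\overline{n},\prec_2)$ respectively, i.e. $R=\Phi_{\prec_1}$ and $\hat R=\Phi_{\prec_2}$. Then $R$ and $\hat R$ are isomorphic as semigroups if and only if there exists an isomorphism or an anti-isomorphism of trees $\eta\colon\omega(R)\to\omega(\hat R)$ such that (i) either $\Gamma^{a}$ is isomorphic to $\Gamma^{a\eta}$ for all $a\in\omega(R)$ with $a>\mathbf{r}_1$, or $\Gamma^{a}$ is anti-isomorphic to $\Gamma^{a\eta}$ for all $a\in\omega(R)$ with $a>\mathbf{r}_1$; and (ii) either $\Gamma^{a}$ is isomorphic to $\Gamma^{a\eta}$ for all $a\in\omega(R)$ with $a<\mathbf{r}_1$, or $\Gamma^{a}$ is anti-isomorphic to $\Gamma^{a\eta}$ for all $a\in\omega(R)$ with $a<\mathbf{r}_1$.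
   Context: **Basics.** $\overline{n}=\{1,\dots,n\}$ with its natural order $\le$; $\mathcal{O}_n$ is the monoid of all transformations $\alpha$ of $\overline{n}$ with $x\le y\Rightarrow x\alpha\le y\alpha$ (maps act on the right). In $\mathcal{O}_n$, $\alpha\mathscr{R}\beta$ iff $\ker\alpha=\ker\beta$. An $\mathscr{R}$-cross-section of $\mathcal{O}_n$ is a subsemigroup containing exactly one element of each $\mathscr{R}$-class. A convex partition of $\overline{n}$ is a partition into intervals. **Trees.** All trees are rooted binary trees: each vertex $v$ has at most one left child (its son $\mathbf{s}(v)$, a male vertex) and at most one right child (its daughter $\mathbf{d}(v)$, a female vertex). $\mathbf{r}$ is the root, $\mathbf{p}(v)$ the parent of $v$, $\omega(v)=\{v,\mathbf{p}(v),\mathbf{p}(\mathbf{p}(v)),\dots,\mathbf{r}\}$. A tree is full if every non-leaf has exactly two children. A homomorphism of trees $T_1\to T_2$ is an injective map of vertex sets sending root to root and preserving the parent–child relation and the genders of non-root vertices; an isomorphism is a bijective homomorphism; an anti-isomorphism is a bijection sending root to root, preserving the parent–child relation and inverting the genders of non-root vertices. $T_1\hookrightarrow T_2$ ($T_1$ subordinates $T_2$) means that a homomorphism $T_1\to T_2$ exists; the empty tree subordinates every tree. **Order-preserving trees.** An order-preserving tree is a tree with vertex set $\overline{n}$ such that every vertex $y$ in the left subtree of $x$ satisfies $y<x$ and every vertex $y$ in the right subtree of $x$ satisfies $x<y$. It is denoted $(\overline{n},\prec)$, where $x\prec y$ means that $x$ is a proper descendant of $y$. ''Highest'' means greatest with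 respect to $\prec$ (every non-empty interval of $\overline{n}$ has a unique highest element). The canonical bounds of the vertices are defined inductively: those of $\mathbf{r}$ are $1,n$; if $v$ has bounds $a\le b$, then $\mathbf{s}(v)$ has bounds $a,v$ and $\mathbf{d}(v)$ has bounds $v,b$. **Inner trees.** Let $1',\dots,(n-1)'$ be symbols ($i'$ is the cell between $i$ and $i+1$). The inner tree $\Gamma$ of $(\overline{n},\prec)$ is the full binary tree whose vertices are intervals of $\{1',\dots,(n-1)'\}$: the root is $[1',(n-1)']$; a vertex $[i',i']$ is a leaf; a vertex $[i',j']$ with $i<j$ has son $[i',(x-1)']$ and daughter $[x',j']$, where $x$ is the highest point with $i<x<j+1$ ($\Gamma$ is empty if $n=1$). For a vertex $x$ with canonical bounds $a<b$, the left inner tree $\Gamma_l(x)$ and the right inner tree $\Gamma_r(x)$ are the subtrees of $\Gamma$ rooted at $[a',(x-1)']$ and $[x',(b-1)']$ respectively; $\Gamma_l(1)=\emptyset$, $\Gamma_r(n)=\emptyset$. **Decreasing trees.** $(\overline{n},\prec)$ is decreasing if for all $x\prec y$ with $x,y\ne\mathbf{r}$: (1) if $x,y\in\omega(1)$ then $\Gamma_r(x)\hookrightarrow\Gamma_r(y)$; (2) if $x,y\in\omega(n)$ then $\Gamma_l(x)\hookrightarrow\Gamma_l(y)$; (3) if $x,y\notin\omega(1)\cup\omega(n)$ then $\Gamma_l(x)\hookrightarrow\Gamma_l(y)$ and $\Gamma_r(x)\hookrightarrow\Gamma_r(y)$. **Partition trees and $\Phi_\prec$.** Let $\widetilde{K}$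 be a convex partition of $\overline{n}$ and let $K^{(a)}$ be the block containing $a$. The partition tree $T(\widetilde{K})$ with respect to $(\overline{n},\prec)$ has vertex set $\widetilde{K}$; its root is $K^{(\mathbf{r})}$. If $V$ is an already defined vertex, let $G$ be the maximal interval of $\overline{n}$ ending at $\min V-1$ that meets neither $V$ nor any ancestor of $V$; if $G\ne\emptyset$ then $\mathbf{s}(V)=K^{(m)}$ where $m$ is the highest element of $G$, otherwise $V$ has no son. The daughter is defined dually, using the maximal such interval starting at $\max V+1$. For a decreasing tree, $\Phi_\prec$ is the set of all transformations $\varphi^{\widetilde K}$, where $\widetilde{K}$ runs over all convex partitions of $\overline{n}$, and $\varphi^{\widetilde{K}}$ maps all elements of each block $K\in\widetilde{K}$ to $Kf$, where $f\colon T(\widetilde{K})\to(\overline{n},\prec)$ is the (unique) tree homomorphism. Every $\mathscr{R}$-cross-section of $\mathcal{O}_n$ has the form $\Phi_\prec$ for a decreasing tree $(\overline n,\prec)$. **Skeleton and elementary pieces.** For $R=\Phi_\prec$, $\omega(R)=\omega(1)\cup\omega(n)$, regarded as a subtree of $(\overline{n},\prec)$ (same root, parents and genders). For $a\in\omega(R)$, $a\neq\mathbf{r}$, $T^a$ is the elementary tree whose vertices are $\mathbf{p}(a)$, $a$ and all $v$ lying strictly between $a$ and $\mathbf{p}(a)$ in the natural order; its inner tree $\Gamma^a$ is $\Gamma_r(a)$ if $a<\mathbf{p}(a)$ and $\Gamma_l(a)$ if $a>\mathbf{p}(a)$. $\Gamma^{a\eta}$ is defined in the same way from $\hat R$ and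 $(\overline{n},\prec_2)$. *)

(* Defs.v *)
From mathcomp Require Import all_boot.

Set Implicit Arguments.
Unset Strict Implicit.
Unset Printing Implicit Defensive.

(* The chain {1, ..., n+1} is 'I_n.+1: the point i is the ordinal of value    *)
(* i - 1, so ord0 is the least point and ord_max the greatest one.            *)

(** * Rooted binary trees *)

(* A tree is given by its root and its partial functions "son" and            *)
(* "daughter"; its vertices are the elements of V reachable from the root,    *)
(* so son and daughter are irrelevant elsewhere. The empty tree has no root.  *)
Record tree (V : finType) := Tree {
  rt : option V;
  son : V -> option V;
  dau : V -> option V }.

Section Trees.
Variable V : finType.
Implicit Types (T : tree V) (p v x y : V).

Definition child T : rel V :=
  fun p v => (son T p == Some v) || (dau T p == Some v).

(* y is x or a descendant of x *)
Definition desceq T x y : bool := connect (child T) x y.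

Definition verts T : {set V} :=
  if rt T is Some r then [set v | desceq T r v] else set0.

(* With reachability built into verts, these are exactly the conditions for a *)
(* rooted binary tree: the root has no parent, and every other vertex has a   *)
(* unique parent and a unique gender.                                         *)
Definition is_tree T : Prop :=
  [/\ forall r p, rt T = Some r -> p \in verts T -> ~~ child T p r,
      forall p q v, p \in verts T -> q \in verts T ->
        child T p v -> child T q v -> p = q
    & forall p v, p \in verts T -> son T p = Some v -> dau T p <> Some v].

Definition parent T v : option V := [pick p | child T p v].

Definition omega T v : {set V} := [set u | desceq T u v].

Definition empty_tree : tree V := Tree None (fun=> None) (fun=> None).

Definition subtree_at T v : tree V := Tree (Some v) (son T) (dau T).

End Trees.

Section Morphisms.
Variables V1 V2 : finType.
Implicit Type f : V1 -> V2.

Definition inj_rooted (T1 : tree V1) (T2 : tree V2) f : Prop :=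
  [/\ {in verts T1, forall x, f x \in verts T2},
      {in verts T1 &, injective f}
    & forall r, rt T1 = Some r -> rt T2 = Some (f r)].

Definition is_hom (T1 : tree V1) (T2 : tree V2) f : Prop :=
  [/\ inj_rooted T1 T2 f,
      {in verts T1, forall x y, son T1 x = Some y -> son T2 (f x) = Some (f y)}
    & {in verts T1, forall x y, dau T1 x = Some y -> dau T2 (f x) = Some (f y)}].

Definition is_iso (T1 : tree V1) (T2 : tree V2) f : Prop :=
  is_hom T1 T2 f /\ f @: verts T1 = verts T2.

Definition is_anti_iso (T1 : tree V1) (T2 : tree V2) f : Prop :=
  [/\ inj_rooted T1 T2 f,
      f @: verts T1 = verts T2,
      {in verts T1, forall x y, son T1 x = Some y -> dau T2 (f x) = Some (f y)}
    & {in verts T1, forall x y, dau T1 x = Some y -> son T2 (f x) = Some (f y)}].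

Definition subordinates (T1 : tree V1) (T2 : tree V2) : Prop :=
  exists f, is_hom T1 T2 f.
Definition isomorphic (T1 : tree V1) (T2 : tree V2) : Prop :=
  exists f, is_iso T1 T2 f.
Definition anti_isomorphic (T1 : tree V1) (T2 : tree V2) : Prop :=
  exists f, is_anti_iso T1 T2 f.

End Morphisms.

(** * Order-preserving trees and their inner trees *)

Section OrderTrees.
Variable n : nat.
Local Notation point := 'I_n.+1.
Local Notation span := (point * point)%type.
Implicit Types (T : tree point) (x y v a b : point) (G : {set point}).

Definition order_preserving T : Prop :=
  [/\ is_tree T,
      verts T = [set: point],
      forall x s y, son T x = Some s -> desceq T s y -> y < x
    & forall x d y, dau T x = Some d -> desceq T d y -> x < y].

Definition below T x y : bool := (x != y) && desceq T y x.

Definition highest T G : option point :=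
  [pick m in G | [forall y in G, desceq T m y]].

(* Canonical bounds, by recursion on the depth of v; depths are at most n, so *)
(* that n.+1 units of fuel suffice.                                           *)
Fixpoint cbounds_rec T (k : nat) v : span :=
  match k, parent T v with
  | k'.+1, Some p =>
      let ab := cbounds_rec T k' p in
      if son T p == Some v then (ab.1, p) else (p, ab.2)
  | _, _ => (ord0, ord_max)
  end.

Definition cbounds T v : span := cbounds_rec T n.+1 v.

(* The interval of cells [i', j'], which fills the gap between the points i   *)
(* and j+1, is encoded by the pair of points (i, j+1). Hence a leaf [i', i']  *)
(* is a pair of consecutive points, and the vertex (a, b) has children (a, x) *)
(* and (x, b), where x is the highest point strictly between a and b.         *)
Definition inner T : tree span :=
  let mid (ab : span) := highest T [set x : point | ab.1 < x < ab.2] in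
  Tree (if n == 0 then None else Some (ord0, ord_max))
       (fun ab => omap (fun x => (ab.1, x)) (mid ab))
       (fun ab => omap (fun x => (x, ab.2)) (mid ab)).

Definition inner_l T x : tree span :=
  if x == ord0 then empty_tree _
  else subtree_at (inner T) ((cbounds T x).1, x).

Definition inner_r T x : tree span :=
  if x == ord_max then empty_tree _
  else subtree_at (inner T) (x, (cbounds T x).2).

Definition omega_ends T : {set point} := omega T ord0 :|: omega T ord_max.

Definition decreasing T : Prop :=
  order_preserving T /\
  forall x y, below T x y -> rt T <> Some x -> rt T <> Some y ->
  [/\ x \in omega T ord0 -> y \in omega T ord0 ->
        subordinates (inner_r T x) (inner_r T y),
      x \in omega T ord_max -> y \in omega T ord_max ->
        subordinates (inner_l T x) (inner_l T y)
    & x \notin omega_ends T -> y \notin omega_ends T ->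
        subordinates (inner_l T x) (inner_l T y) /\
        subordinates (inner_r T x) (inner_r T y)].

(* omega(R) as a subtree *)
Definition skeleton T : tree point :=
  let restr o := if o is Some v then if v \in omega_ends T then Some v else None
                 else None in
  Tree (rt T) (fun x => restr (son T x)) (fun x => restr (dau T x)).

(* Gamma^a; the value at the root is irrelevant *)
Definition inner_at T a : tree span :=
  if parent T a is Some p then
    if a < p then inner_r T a else inner_l T a
  else empty_tree _.

(** * Partition trees and the sets Phi *)

Implicit Types (K : {set {set point}}) (W : {set point}).

Definition convex_partition K : Prop :=
  partition K [set: point] /\
  forall W, W \in K -> forall x y z,
    x \in W -> z \in W -> x <= y <= z -> y \in W.

(* the union of the block W and of its ancestors in the tree P *)
Definition covered (P : tree {set point}) W : {set point} :=
  \bigcup_(U in verts P | desceq P U W) U.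

(* the maximal interval ending just before W (resp. starting just after W)    *)
(* that avoids W and its ancestors                                            *)
Definition gap_l (P : tree {set point}) W : {set point} :=
  [set x : point | [forall w in W, x < w] &&
     [forall y : point, (x <= y) && [forall w in W, y < w] ==> (y \notin covered P W)]].

Definition gap_r (P : tree {set point}) W : {set point} :=
  [set x : point | [forall w in W, w < x] &&
     [forall y : point, (y <= x) && [forall w in W, w < y] ==> (y \notin covered P W)]].

(* P is the partition tree of K with respect to T; the ancestors of a block   *)
(* in P are determined before its children, so these clauses determine P.     *)
Definition is_partition_tree T K (P : tree {set point}) : Prop :=
  [/\ is_tree P,
      verts P = K,
      rt P = omap (pblock K) (rt T),
      forall W, W \in K -> son P W = omap (pblock K) (highest T (gap_l P W))
    & forall W, W \in K -> dau P W = omap (pblock K) (highest T (gap_r P W))].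

Definition Phi T (phi : {ffun point -> point}) : Prop :=
  exists (K : {set {set point}}) (P : tree {set point}) (f : {set point} -> point),
    [/\ convex_partition K, is_partition_tree T K P, is_hom P T f
      & forall x, phi x = f (pblock K x)].

End OrderTrees.

(** * Semigroups of order-preserving transformations *)

(* maps act on the right: x (alpha beta) = (x alpha) beta *)
Definition tmul (X : finType) (alpha beta : {ffun X -> X}) : {ffun X -> X} :=
  [ffun x => beta (alpha x)].

Definition op_transf (n : nat) : {set {ffun 'I_n.+1 -> 'I_n.+1}} :=
  [set alpha : {ffun 'I_n.+1 -> 'I_n.+1} |
    [forall x : 'I_n.+1, forall y : 'I_n.+1, (x <= y) ==> (alpha x <= alpha y)]].

(* Green's relation R on the monoid of order-preserving transformations:      *)
(* equality of kernels                                                        *)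
Definition greenR (n : nat) (alpha beta : {ffun 'I_n.+1 -> 'I_n.+1}) : Prop :=
  forall x y, alpha x = alpha y <-> beta x = beta y.

Definition R_cross_section (n : nat) (R : {set {ffun 'I_n.+1 -> 'I_n.+1}}) : Prop :=
  [/\ R \subset op_transf n,
      {in R &, forall alpha beta, tmul alpha beta \in R}
    & forall alpha, alpha \in op_transf n ->
        exists! beta, beta \in R /\ greenR alpha beta].

Definition semigroup_isomorphic (X : finType) (R S : {set {ffun X -> X}}) : Prop :=
  exists F : {ffun X -> X} -> {ffun X -> X},
    [/\ {in R &, injective F}, F @: R = S
      & {in R &, {morph F : alpha beta / tmul alpha beta}}].

(* Main.v *)
Require Import Defs.
From mathcomp Require Import all_boot.

Set Implicit Arguments.
Unset Strict Implicit.
Unset Printing Implicit Defensive.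

(* Let a cell be a gap between two consecutive points. A member of Phi is     *)
(* determined by the set S of the cells at which it jumps, and any S occurs.  *)
(* It sends a cell c of S to an interval of cells, and c is a jump of the     *)
(* product phi_S phi_S' iff this interval meets S'. Right divisibility is     *)
(* inclusion of the sets S, hence an isomorphism is induced by a bijection of *)
(* the cells that preserves the relation: d lies in the image of c under      *)
(* phi_S. The interval of c is computed by restricting the trees Gamma^a of   *)
(* a spine to S and embedding the j-th nonempty restriction into the j-th     *)
(* tree of the spine. Singletons S then tell apart the two spines, pairs tell *)
(* apart the trees of a spine and order them; inside a tree, a pair of cells  *)
(* is sent to the two halves of the first tree of the spine, so the bijection *)
(* preserves or reverses the order simultaneously in all trees of a spine.    *)
(* Up to a mirror image it preserves the splitting of each tree at its root,  *)
(* and, adding one cell of the other half to S, of all its subtrees.          *)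

(** * Leaf-labelled binary trees *)

(** A cell is named by its left end. A member phi of a cross-section is fixed by its kernel, hence
    by its set S of jumps, and every set of cells occurs ([jumps_inj], [jumps_onto]). A product
    jumps at c iff the second factor jumps somewhere between the images of the two ends of c, so the
    semigroup is known once these intervals are known for every S.

    The trees enter through a naturality property of homomorphisms of partition trees
    ([hom_natural]): the highest point of a set is sent to the highest point of an interval, as soon
    as it lands there and everything else that lands there comes from the set. Hence phi carries the
    splitting point of a gap to the splitting point of the image gap unless phi is constant on one
    half, and such a half contains no jump. This recursion is [hit] inside one inner tree, [chit]
    along a spine and [whit] on both spines; [whit_jumps] identifies it with the intervals above,
    and [cross_model] collects the outcome. Since right divisibility is inclusion of jump sets,
    isomorphisms of semigroups amount to bijections of cells that carry [whit] to [whit]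
    ([iso_transports], [transports_iso]).

    What remains is combinatorial. Such a bijection can be decoded from small sets S: it keeps or
    exchanges the spines, keeps the order of the trees on each spine, and on each spine either
    copies all the trees or reflects them all ([linked_alike]). Conversely, reflecting source and
    target together does not change [chit], so equality of shapes up to one reflection per spine
    yields a bijection by matching leaves in order ([alike_linked]). Finally the skeleton is a root
    with two paths, so an isomorphism or anti-isomorphism of skeletons is a matching of the spines,
    kept or exchanged ([skel_rep], [rep_iso], [rep_anti]), and the trees along the spines are the
    inner trees of the elementary pieces ([lchain_inner_at], [rchain_inner_at]). *)

Inductive btree (L : Type) := Lf of L | Nd of btree L & btree L.

Fixpoint leaves (L : Type) (u : btree L) : seq L :=
  match u with Lf a => [:: a] | Nd u1 u2 => leaves u1 ++ leaves u2 end.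

Fixpoint mirror (L : Type) (u : btree L) : btree L :=
  match u with Lf a => Lf a | Nd u1 u2 => Nd (mirror u2) (mirror u1) end.

Fixpoint tmap (L M : Type) (f : L -> M) (u : btree L) : btree M :=
  match u with Lf a => Lf (f a) | Nd u1 u2 => Nd (tmap f u1) (tmap f u2) end.

Definition shape (L : Type) : btree L -> btree unit := tmap (fun=> tt).

Definition labels (L : Type) (us : seq (btree L)) : seq L := flatten (map (@leaves L) us).

Lemma mirrorK (L : Type) : involutive (@mirror L).
Proof. by elim=> //= u1 -> u2 ->. Qed.

Lemma leaves_tmap (L M : Type) (f : L -> M) u : leaves (tmap f u) = map f (leaves u).
Proof. by elim: u => //= u1 -> u2 ->; rewrite map_cat. Qed.

Lemma tmap_mirror (L M : Type) (f : L -> M) u : tmap f (mirror u) = mirror (tmap f u).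
Proof. by elim: u => //= u1 -> u2 ->. Qed.

Lemma shape_tmap (L M : Type) (f : L -> M) u : shape (tmap f u) = shape u.
Proof. by rewrite /shape; elim: u => //= u1 -> u2 ->. Qed.

Section Hit.
Variable L : finType.
Implicit Types (u t : btree L) (us ts : seq (btree L)) (S A : {set L}) (x y c d : L).

Lemma leaf_ex u : exists x, x \in leaves u.
Proof.
elim: u => [a|u1 [x xu] u2 _] /=; first by exists a; rewrite inE.
by exists x; rewrite mem_cat xu.
Qed.

Lemma mem_mirror u : leaves (mirror u) =i leaves u.
Proof. by elim: u => //= u1 IH1 u2 IH2 x; rewrite !mem_cat IH1 IH2 orbC. Qed.

Lemma mirror_uniq u : uniq (leaves (mirror u)) = uniq (leaves u).
Proof.
elim: u => //= u1 IH1 u2 IH2; rewrite !cat_uniq IH1 IH2.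
rewrite (eq_has_r (mem_mirror u1)) (eq_has (mem_mirror u2)) has_sym.
by case: (uniq (leaves u1)); case: (uniq (leaves u2)); rewrite ?andbF ?andbT.
Qed.

Lemma labels_mirror us : labels (map (@mirror L) us) =i labels us.
Proof.
move=> x; elim: us => //= u us IH.
by rewrite /labels /= !mem_cat mem_mirror; congr orb.
Qed.

Lemma uniq_labels_mirror us : uniq (labels (map (@mirror L) us)) = uniq (labels us).
Proof.
elim: us => //= u us IH; rewrite /labels /= !cat_uniq mirror_uniq.
rewrite (eq_has (mem_mirror u)); congr [&& _, ~~ _ & _]; last exact: IH.
exact: (eq_has_r (labels_mirror us)).
Qed.

(** * Restricting a tree to a set of leaves and embedding the restriction *)

Definition meets S u : bool := has (mem S) (leaves u).

(* Restrict [u] to its leaves in [S] and embed the restriction at the root of *)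
(* [t]: the leaf [c] becomes a vertex of [t], and [hit u t S c d] says that   *)
(* [d] is a leaf under it (junk value [false] if there is no embedding).      *)
Fixpoint hit u t S c d : bool :=
  match u with
  | Lf a => [&& c == a, a \in S & d \in leaves t]
  | Nd u1 u2 =>
    if ~~ meets S u1 then hit u2 t S c d
    else if ~~ meets S u2 then hit u1 t S c d
    else if t is Nd t1 t2 then hit u1 t1 S c d || hit u2 t2 S c d else false
  end.

(* The same for two sequences of trees hanging on a spine: the trees of [us]  *)
(* that do not meet [S] are skipped, the j-th remaining one goes to the j-th  *)
(* tree of [ts].                                                              *)
Fixpoint chit us ts S c d : bool :=
  if us is u :: us' then
    if meets S u then
      if ts is t :: ts' then hit u t S c d || chit us' ts' S c d else false
    else chit us' ts S c d
  else false.

Lemma meetsP S u : reflect (exists2 x, x \in leaves u & x \in S) (meets S u).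
Proof. exact: hasP. Qed.

Lemma meets_mirror S u : meets S (mirror u) = meets S u.
Proof. by rewrite /meets (eq_has_r (mem_mirror u)). Qed.

Lemma hit_in u t S c d : hit u t S c d -> (c \in leaves u) /\ (c \in S).
Proof.
elim: u t => [a|u1 IH1 u2 IH2] t /=.
  by case/and3P=> /eqP-> aS _; rewrite inE.
case: ifP => _; first by case/IH2=> ? ?; rewrite mem_cat orbC; split=> //; apply/orP; left.
case: ifP => _; first by case/IH1=> ? ?; rewrite mem_cat; split=> //; apply/orP; left.
case: t => // t1 t2 /orP[/IH1|/IH2] [ci cS]; rewrite mem_cat ci ?orbT; by split.
Qed.

Lemma hit_notin u t S c d : c \notin leaves u -> hit u t S c d = false.
Proof. by move=> cu; apply/negP=> /hit_in[]; rewrite (negPf cu). Qed.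

Lemma hit_meets u t S c d : ~~ meets S u -> hit u t S c d = false.
Proof.
by move=> nm; apply/negP=> /hit_in[cu cS]; case/negP: nm; apply/meetsP; exists c.
Qed.

(** Reflecting source and target together changes nothing. This is the freedom that allows
    anti-isomorphic inner trees in the theorem. *)
Lemma hit_mirror u t S c d : hit (mirror u) (mirror t) S c d = hit u t S c d.
Proof.
elim: u t => [a|u1 IH1 u2 IH2] t /=; first by rewrite mem_mirror.
rewrite !meets_mirror; have [m1|m1] := boolP (meets S u1); have [m2|m2] := boolP (meets S u2) => //=.
  by case: t => //= t1 t2; rewrite IH1 IH2 orbC.
(* Neither half meets [S]: the two sides descend into opposite halves, and both give [false]. *)
by rewrite IH1 !hit_meets.
Qed.

Lemma chit_mirror us ts S c d :
  chit (map (@mirror L) us) (map (@mirror L) ts) S c d = chit us ts S c d.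
Proof.
elim: us ts => //= u us IH ts; rewrite meets_mirror; case: ifP => _ //.
by case: ts => //= t ts; rewrite hit_mirror IH.
Qed.

Lemma meets_ext u S S' : {in leaves u, S =i S'} -> meets S u = meets S' u.
Proof. by move=> e; apply: eq_in_has => x xu; apply: e. Qed.

Lemma hit_ext u t S S' c d : {in leaves u, S =i S'} -> hit u t S c d = hit u t S' c d.
Proof.
elim: u t => [a|u1 IH1 u2 IH2] t /= e; first by rewrite e ?inE.
have e1 : {in leaves u1, S =i S'} by move=> x xu; apply: e; rewrite mem_cat xu.
have e2 : {in leaves u2, S =i S'} by move=> x xu; apply: e; rewrite mem_cat xu orbT.
rewrite (meets_ext e1) (meets_ext e2) (IH1 _ e1) (IH2 _ e2).
by case: t => // t1 t2; rewrite (IH1 _ e1) (IH2 _ e2).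
Qed.

Lemma chit_ext us ts S S' c d :
  {in labels us, S =i S'} -> chit us ts S c d = chit us ts S' c d.
Proof.
elim: us ts => //= u us IH ts; rewrite /labels /= => e.
have e1 : {in leaves u, S =i S'} by move=> x xu; apply: e; rewrite mem_cat xu.
have e2 : {in labels us, S =i S'} by move=> x xu; apply: e; rewrite mem_cat xu orbT.
by rewrite (meets_ext e1); case: ts => [|t ts]; rewrite ?(hit_ext _ _ _ e1) !(IH _ e2).
Qed.

Lemma chit_in us ts S c d : chit us ts S c d -> (c \in labels us) /\ (c \in S).
Proof.
elim: us ts => //= u us IH ts; rewrite /labels /= mem_cat.
case: ifP => _; last by case/IH=> -> ->; rewrite orbT.
by case: ts => // t ts /orP[/hit_in|/IH] [-> ->]; rewrite ?orbT.
Qed.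

Lemma chit_notin us ts S c d : c \notin labels us -> chit us ts S c d = false.
Proof. by move=> cu; apply/negP=> /chit_in[]; rewrite (negPf cu). Qed.

Lemma meets_map (f : L -> L) S u : injective f -> meets (f @: S) (tmap f u) = meets S u.
Proof.
by move=> fI; rewrite /meets leaves_tmap has_map; apply: eq_has => x /=; rewrite mem_imset.
Qed.

Lemma hit_map (f : L -> L) u t S c d : injective f ->
  hit (tmap f u) (tmap f t) (f @: S) (f c) (f d) = hit u t S c d.
Proof.
move=> fI; elim: u t => [a|u1 IH1 u2 IH2] t /=.
  by rewrite leaves_tmap mem_map // mem_imset // inj_eq.
by rewrite !meets_map // IH1 IH2; case: t => //= t1 t2; rewrite IH1 IH2.
Qed.

Lemma chit_map (f : L -> L) us ts S c d : injective f ->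
  chit (map (tmap f) us) (map (tmap f) ts) (f @: S) (f c) (f d) = chit us ts S c d.
Proof.
move=> fI; elim: us ts => //= u us IH ts; rewrite meets_map //; case: ifP => _ //.
by case: ts => //= t ts; rewrite hit_map ?IH.
Qed.

(** * The position of two leaves, read off from singletons and pairs *)

Fixpoint lft u x y : bool :=
  if u is Nd u1 u2 then
    [|| (x \in leaves u1) && (y \in leaves u2), lft u1 x y | lft u2 x y]
  else false.

Lemma lft_in u x y : lft u x y -> (x \in leaves u) /\ (y \in leaves u).
Proof.
elim: u => //= u1 IH1 u2 IH2; rewrite !mem_cat.
by case/or3P=> [/andP[-> ->]|/IH1[-> ->]|/IH2[-> ->]]; rewrite ?orbT.
Qed.

Lemma lft_mirror u x y : lft (mirror u) x y = lft u y x.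
Proof.
elim: u => //= u1 -> u2 ->; rewrite !mem_mirror [in LHS]andbC.
by congr orb; rewrite orbC.
Qed.

Lemma lft_total u x y : x \in leaves u -> y \in leaves u -> x != y ->
  lft u x y || lft u y x.
Proof.
elim: u => [a|u1 IH1 u2 IH2] /=; first by rewrite !inE => /eqP-> /eqP->; rewrite eqxx.
rewrite !mem_cat => /orP[x1|x2] /orP[y1|y2] xy.
- by case/orP: (IH1 x1 y1 xy) => ->; rewrite ?orbT.
- by rewrite x1 y2.
- by rewrite x2 y1 ?orbT.
- by case/orP: (IH2 x2 y2 xy) => ->; rewrite ?orbT.
Qed.

Lemma cat_uniqP (s1 s2 : seq L) : uniq (s1 ++ s2) ->
  [/\ uniq s1, uniq s2, forall x, x \in s1 -> x \notin s2 & forall x, x \in s2 -> x \notin s1].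
Proof.
rewrite cat_uniq => /and3P[u1 /hasPn h u2]; split=> // x.
by move=> x1; apply/negP=> /h; rewrite /= x1.
Qed.

Lemma lft_neq u x y : uniq (leaves u) -> lft u x y -> x != y.
Proof.
elim: u => //= u1 IH1 u2 IH2 /cat_uniqP[n1 n2 d1 d2].
case/or3P=> [/andP[x1 y2]|/IH1->|/IH2->] //.
by apply: contraTneq x1 => ->; rewrite d2.
Qed.

Lemma meets2_no x y u : x \notin leaves u -> y \notin leaves u ->
  meets [set x; y] u = false.
Proof.
move=> xu yu; apply/negP=> /meetsP[z zu]; rewrite !inE => /orP[]/eqP e; subst z.
  by rewrite zu in xu.
by rewrite zu in yu.
Qed.

(** The restriction is a single leaf and is embedded at the root. [S] is prescribed on the leaves of
    [u] only, so that it may have cells in other trees. *)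
Lemma hit1 u t x S d : uniq (leaves u) -> x \in leaves u ->
  {in leaves u, forall y, (y \in S) = (y == x)} ->
  hit u t S x d = (d \in leaves t).
Proof.
elim: u t => [a|u1 IH1 u2 IH2] t /=.
  by move=> _; rewrite inE => /eqP-> h; rewrite h ?inE // !eqxx.
case/cat_uniqP=> n1 n2 d1 d2; rewrite mem_cat => xu h.
have [h1 h2] : {in leaves u1, forall y, (y \in S) = (y == x)} /\
  {in leaves u2, forall y, (y \in S) = (y == x)}.
  by split=> y yu; apply: h; rewrite mem_cat yu ?orbT.
have me v : {in leaves v, forall y, (y \in S) = (y == x)} -> meets S v = (x \in leaves v).
  move=> hv; apply/meetsP/idP => [[y yv]|xv]; first by rewrite hv // => /eqP<-.
  by exists x => //; rewrite hv.
rewrite !me //; case: (boolP (x \in leaves u1)) => x1 /=; last first.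
  by rewrite IH2 //; rewrite (negPf x1) in xu.
by rewrite d1 //= IH1.
Qed.

(** Wherever in [u] the two leaves part, the restriction is one fork, and this fork is embedded at
    the root of [t]. *)
Lemma hit2 u t x y d : uniq (leaves u) -> lft u x y ->
  hit u t [set x; y] x d = (if t is Nd t1 _ then d \in leaves t1 else false) /\
  hit u t [set x; y] y d = (if t is Nd _ t2 then d \in leaves t2 else false).
Proof.
elim: u t => //= u1 IH1 u2 IH2 t /cat_uniqP[n1 n2 d1 d2].
case/or3P=> [/andP[x1 y2]|l1|l2].
- have -> : meets [set x; y] u1 by apply/meetsP; exists x; rewrite // !inE eqxx.
  have -> : meets [set x; y] u2 by apply/meetsP; exists y; rewrite // !inE eqxx orbT.
  case: t => //= t1 t2; rewrite (hit_notin _ _ _ (d1 _ x1)) (hit_notin _ _ _ (d2 _ y2)) orbF /=.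
  split; apply: hit1 => // z zu; rewrite !inE.
    by rewrite (_ : z == y = false) ?orbF //; apply: contraTF zu => /eqP->; rewrite d2.
  by rewrite (_ : z == x = false) //; apply: contraTF zu => /eqP->; rewrite d1.
- have [x1 y1] := lft_in l1.
  have -> : meets [set x; y] u1 by apply/meetsP; exists x; rewrite // !inE eqxx.
  by rewrite meets2_no ?d1 //; apply: IH1.
- have [x1 y1] := lft_in l2.
  by rewrite meets2_no ?d2 //; apply: IH2.
Qed.

Lemma labels_cons u us : labels (u :: us) = leaves u ++ labels us.
Proof. by []. Qed.

Fixpoint before us x y : bool :=
  if us is u :: us' then ((x \in leaves u) && (y \in labels us')) || before us' x y
  else false.

Definition clft us x y : bool := has (fun u => lft u x y) us.

Lemma before_in us x y : before us x y -> (x \in labels us) /\ (y \in labels us).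
Proof.
elim: us => //= u us IH; rewrite labels_cons !mem_cat.
by case/orP=> [/andP[-> ->]|/IH[-> ->]]; rewrite ?orbT.
Qed.

Lemma clft_in us x y : clft us x y -> (x \in labels us) /\ (y \in labels us).
Proof.
elim: us => //= u us IH; rewrite labels_cons !mem_cat.
by case/orP=> [/lft_in[-> ->]|/IH[-> ->]]; rewrite ?orbT.
Qed.

Lemma clft_mirror us x y : clft (map (@mirror L) us) x y = clft us y x.
Proof. by elim: us => //= u us ->; rewrite lft_mirror. Qed.

Lemma clft_neq us x y : uniq (labels us) -> clft us x y -> x != y.
Proof.
elim: us => //= u us IH; rewrite labels_cons => /cat_uniqP[n1 n2 _ _].
by case/orP=> [/(lft_neq n1)|/(IH n2)].
Qed.

Lemma label_cases us x y : x \in labels us -> y \in labels us -> x != y ->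
  [\/ before us x y, before us y x, clft us x y | clft us y x].
Proof.
elim: us => //= u us IH; rewrite labels_cons !mem_cat.
case/orP=> xu /orP[] yu xy.
- by case/orP: (lft_total xu yu xy) => l; [apply: Or43|apply: Or44]; rewrite l.
- by apply: Or41; rewrite xu yu.
- by apply: Or42; rewrite xu yu.
- by case: (IH xu yu xy) => l; [apply: Or41|apply: Or42|apply: Or43|apply: Or44];
    rewrite l orbT.
Qed.

Lemma chit_nil us S c d : chit us [::] S c d = false.
Proof. by elim: us => //= u us ->; case: ifP. Qed.

Lemma chit1 us t ts x S d : uniq (labels us) -> x \in labels us ->
  {in labels us, forall y, (y \in S) = (y == x)} ->
  chit us (t :: ts) S x d = (d \in leaves t).
Proof.
elim: us => //= u us IH; rewrite labels_cons => /cat_uniqP[n1 n2 d1 d2].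
rewrite mem_cat => xu h.
have h1 : {in leaves u, forall y, (y \in S) = (y == x)} by move=> y yu; apply: h; rewrite mem_cat yu.
have h2 : {in labels us, forall y, (y \in S) = (y == x)}.
  by move=> y yu; apply: h; rewrite mem_cat yu orbT.
case: meetsP => [[y yu yS]|nm].
  have yx : y = x by apply/eqP; rewrite -h1.
  subst y.
  by rewrite (chit_notin _ _ _ (d1 _ yu)) orbF (hit1 _ _ n1).
apply: IH => //; case/orP: xu => // xu; case: nm; exists x => //; by rewrite h1.
Qed.

(** Trees without [x] and [y] are skipped, so the fork lands on the first target tree whichever tree
    contains it. This ties together the orientations of all trees of a spine. *)
Lemma chit2_clft us t ts x y d : uniq (labels us) -> clft us x y ->
  chit us (t :: ts) [set x; y] x d = (if t is Nd t1 _ then d \in leaves t1 else false) /\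
  chit us (t :: ts) [set x; y] y d = (if t is Nd _ t2 then d \in leaves t2 else false).
Proof.
elim: us => //= u us IH; rewrite labels_cons => /cat_uniqP[n1 n2 d1 d2].
case/orP=> [l|l].
  have [xu yu] := lft_in l.
  have -> : meets [set x; y] u by apply/meetsP; exists x; rewrite // !inE eqxx.
  by rewrite !(chit_notin _ _ _ (d1 _ _)) // !orbF; apply: hit2.
have [xu yu] := clft_in l.
by rewrite meets2_no ?d2 //; apply: IH.
Qed.

Lemma chit2_before us t ts x y d : uniq (labels us) -> before us x y ->
  chit us (t :: ts) [set x; y] x d = (d \in leaves t) /\
  chit us (t :: ts) [set x; y] y d = (if ts is t2 :: _ then d \in leaves t2 else false).
Proof.
elim: us => //= u us IH; rewrite labels_cons => /cat_uniqP[n1 n2 d1 d2].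
case/orP=> [/andP[xu yu]|l].
  have -> : meets [set x; y] u by apply/meetsP; exists x; rewrite // !inE eqxx.
  rewrite (chit_notin _ _ _ (d1 _ xu)) orbF (hit_notin _ _ _ (d2 _ yu)) /=; split.
    apply: hit1 => // z zu; rewrite !inE (_ : z == y = false) ?orbF //.
    by apply: contraTF zu => /eqP->; rewrite d2.
  case: ts {IH} => [|t2 ts]; first by rewrite chit_nil.
  apply: chit1 => // z zu; rewrite !inE (_ : z == x = false) //.
  by apply: contraTF zu => /eqP->; rewrite d1.
have [xu yu] := before_in l.
by rewrite meets2_no ?d2 //; apply: IH.
Qed.

(** Says that the junk value [false] does no harm: every cell of [S] gets a nonempty image. For a
    cross-section it holds because every [S] is the jump set of a member. *)
Definition fills us := forall S c, {subset S <= labels us} -> c \in S ->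
  exists d, chit us us S c d.

Lemma sub2 (s : seq L) x y : x \in s -> y \in s -> {subset [set x; y] <= s}.
Proof. by move=> xs ys z; rewrite !inE => /orP[]/eqP->. Qed.

(* [before] is thus expressed by the product of the semigroup alone. *)
Lemma beforeE us x y : uniq (labels us) -> fills us ->
  x \in labels us -> y \in labels us -> x != y ->
  reflect (forall d, chit us us [set x; y] x d = chit us us [set x] x d)
          (before us x y).
Proof.
move=> un fi xu yu xy.
have c1 e : chit us us [set x] x e = (if us is t :: _ then e \in leaves t else false).
  by case: (us) un xu => // t ts un xu; apply: chit1 => // z _; rewrite !inE.
apply: (iffP idP) => [b e|h].
  by rewrite c1; case: (us) un b => // t ts un b; case: (chit2_before t ts e un b).
(* The image of [x] is nonempty and, by [h], is the whole first tree. In the other positions it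
   would lie in the second tree or in one half of the first. *)
have [d hd] := fi [set x; y] x (sub2 xu yu) (set21 x y).
have := h d; rewrite hd c1 => /esym dh.
case: (label_cases xu yu xy) => //.
- rewrite (setUC [set x]) in hd * => b; case: us un b {fi xu yu h c1} hd dh => // t ts un b.
  have [_ ->] := chit2_before t ts d un b.
  case: ts un {b} => // t2 ts; rewrite !labels_cons => /cat_uniqP[_ _ d1 d2].
  by move=> dt2 dt; have := d1 _ dt; rewrite mem_cat dt2.
- move=> b; case: us un b {fi xu yu hd} h dh c1 => // t ts un b h dh c1.
  have [] := chit2_clft t ts d un b.
  rewrite h c1 dh; case: t un b h c1 dh => // t1 t2 un b h c1 _ _ _.
  have [z zt] := leaf_ex t2.
  have [e _] := chit2_clft (Nd t1 t2) ts z un b.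
  have := h z; rewrite e c1 /= mem_cat zt orbT.
  by move: un; rewrite labels_cons => /cat_uniqP[/cat_uniqP[_ _ _ d2] _ _ _]; rewrite (negPf (d2 _ zt)).
- move=> b; case: us un b {fi xu yu hd} h dh c1 => // t ts un b h dh c1.
  rewrite (setUC [set x]) in h.
  have [_] := chit2_clft t ts d un b.
  rewrite h c1 dh; case: t un b h c1 dh => // t1 t2 un b h c1 _ _.
  have [z zt] := leaf_ex t1.
  have [_ e] := chit2_clft (Nd t1 t2) ts z un b.
  have := h z; rewrite e c1 /= mem_cat zt.
  by move: un; rewrite labels_cons => /cat_uniqP[/cat_uniqP[_ _ d1 _] _ _ _]; rewrite (negPf (d1 _ zt)).
Qed.

(** A leaf of [u] added to [S] uses up the first target tree, and the rest of [S] then sees the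
    chain [us] alone. *)
Lemma fills_tail u us : uniq (labels (u :: us)) -> fills (u :: us) -> fills us.
Proof.
rewrite labels_cons => /cat_uniqP[_ _ d1 d2] fi S c Ss cS.
have [z zu] := leaf_ex u.
have [|d] := fi (z |: S) c _ (setU1r _ cS).
  move=> x; rewrite labels_cons mem_cat !inE => /orP[/eqP->|/Ss->]; rewrite ?zu ?orbT //.
rewrite /= (_ : meets _ _); last by apply/meetsP; exists z; rewrite ?setU11.
rewrite hit_notin ?d2 ?Ss //= => h; exists d.
rewrite (@chit_ext _ _ S (z |: S)) // => x xu; rewrite !inE; case: eqP => // xz.
by move: (d1 _ zu); rewrite -xz xu.
Qed.

(** * Bijections of leaves that carry images to images *)

Section Transport.
Variables f g : L -> L.
Hypotheses (fK : cancel f g) (gK : cancel g f).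
Let fI : injective f := can_inj fK.

Definition tpres u u' := forall S c d, {subset S <= leaves u} -> c \in S ->
  hit u u S c d = hit u' u' (f @: S) (f c) (f d).

Definition cpres us us' := forall S c d, {subset S <= labels us} -> c \in S ->
  chit us us S c d = chit us' us' (f @: S) (f c) (f d).

(** One leaf of the opposite half, added to [S], makes the restriction fork at the root. The part of
    [S] in a half is then embedded as if that half stood alone. *)
Lemma tpres_son u1 u2 u1' u2' :
  uniq (leaves (Nd u1 u2)) -> uniq (leaves (Nd u1' u2')) ->
  (forall x, (f x \in leaves u1') = (x \in leaves u1)) ->
  (forall x, (f x \in leaves u2') = (x \in leaves u2)) ->
  tpres (Nd u1 u2) (Nd u1' u2') -> tpres u1 u1' /\ tpres u2 u2'.
Proof.
move=> /= /cat_uniqP[_ _ d1 d2] /cat_uniqP[_ _ d1' d2'] e1 e2 tp.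
have [z1 z1u] := leaf_ex u1; have [z2 z2u] := leaf_ex u2.
split=> S c d Ss cS.
  have := tp (z2 |: S) c d _ (setU1r _ cS).
  rewrite /= (_ : meets _ u1); last by apply/meetsP; exists c; rewrite ?Ss ?setU1r.
  rewrite (_ : meets _ u2); last by apply/meetsP; exists z2; rewrite ?setU11.
  rewrite (_ : meets _ u1'); last first.
    by apply/meetsP; exists (f c); rewrite ?e1 ?Ss // mem_imset // setU1r.
  rewrite (_ : meets _ u2'); last first.
    by apply/meetsP; exists (f z2); rewrite ?e2 // mem_imset // setU11.
  rewrite /= (hit_notin _ _ _ (d1 _ (Ss _ cS))) (@hit_notin u2'); last by rewrite e2 d1 ?Ss.
  rewrite !orbF => h.
  rewrite (@hit_ext _ _ S (z2 |: S)) ?h; first last.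
  - move=> x xu; rewrite !inE; case: eqP => // xz.
    by move: (d2 _ z2u); rewrite -xz xu.
  - by move=> x; rewrite !inE /= mem_cat => /orP[/eqP->|/Ss->]; rewrite ?z2u ?orbT.
  apply: hit_ext => x xu; rewrite imsetU1 !inE; case: eqP => //= xz.
  by move: xu; rewrite xz e1 (negPf (d2 _ z2u)).
have := tp (z1 |: S) c d _ (setU1r _ cS).
rewrite /= (_ : meets _ u1); last by apply/meetsP; exists z1; rewrite ?setU11.
rewrite (_ : meets _ u2); last by apply/meetsP; exists c; rewrite ?Ss ?setU1r.
rewrite (_ : meets _ u1'); last first.
  by apply/meetsP; exists (f z1); rewrite ?e1 // mem_imset // setU11.
rewrite (_ : meets _ u2'); last first.
  by apply/meetsP; exists (f c); rewrite ?e2 ?Ss // mem_imset // setU1r.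
rewrite /= (hit_notin _ _ _ (d2 _ (Ss _ cS))) (@hit_notin u1'); last by rewrite e1 d2 ?Ss.
rewrite /= => h.
rewrite (@hit_ext _ _ S (z1 |: S)) ?h; first last.
- move=> x xu; rewrite !inE; case: eqP => // xz.
  by move: (d1 _ z1u); rewrite -xz xu.
- by move=> x; rewrite !inE /= mem_cat => /orP[/eqP->|/Ss->]; rewrite ?z1u ?orbT.
apply: hit_ext => x xu; rewrite imsetU1 !inE; case: eqP => //= xz.
by move: xu; rewrite xz e2 (negPf (d1 _ z1u)).
Qed.

(** Two leaves on opposite sides of the root have exactly the two halves as images, so [f] carries
    halves to halves and the argument repeats inside each. Preservation of [lft] settles which half
    is which. *)
Lemma tree_transport u u' : uniq (leaves u) -> uniq (leaves u') ->
  (forall x, (f x \in leaves u') = (x \in leaves u)) -> tpres u u' ->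
  (forall x y, lft u x y -> lft u' (f x) (f y)) -> u' = tmap f u.
Proof.
elim: u u' => [a|u1 IH1 u2 IH2] [b|v1 v2] nu nv e tp l.
- by have := e a; rewrite !inE eqxx => /eqP /= ->.
(* A bijection cannot match a single leaf with the two or more leaves of a node. *)
- have [p pv] := leaf_ex v1; have [q qv] := leaf_ex v2.
  have := e (g p); have := e (g q); rewrite !gK /= !mem_cat pv qv orbT !inE.
  move=> /esym/eqP qa /esym/eqP pa; case/cat_uniqP: nv => _ _ _ d2.
  by move: (d2 _ qv); rewrite -(gK q) qa -pa gK pv.
- have [p pv] := leaf_ex u1; have [q qv] := leaf_ex u2.
  have := e p; have := e q; rewrite /= !mem_cat pv qv orbT !inE.
  move=> /eqP qb /eqP pb; case/cat_uniqP: nu => _ _ _ d2.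
  by move: (d2 _ qv); rewrite -(fK q) qb -pb fK pv.
have [p pv] := leaf_ex u1; have [q qv] := leaf_ex u2.
have lpq : lft (Nd u1 u2) p q by rewrite /= pv qv.
have pq := sub2 (proj1 (lft_in lpq)) (proj2 (lft_in lpq)).
have e1 x : (f x \in leaves v1) = (x \in leaves u1).
  have := tp _ p x pq (set21 p q).
  have [-> _] := hit2 (Nd u1 u2) x nu lpq.
  by rewrite imsetU1 imset_set1; have [-> _] := hit2 (Nd v1 v2) (f x) nv (l _ _ lpq).
have e2 x : (f x \in leaves v2) = (x \in leaves u2).
  have := tp _ q x pq (set22 p q).
  have [_ ->] := hit2 (Nd u1 u2) x nu lpq.
  by rewrite imsetU1 imset_set1; have [_ ->] := hit2 (Nd v1 v2) (f x) nv (l _ _ lpq).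
have [tp1 tp2] := tpres_son nu nv e1 e2 tp.
case/cat_uniqP: nu nv => n1 n2 d1 d2 /cat_uniqP[n1' n2' d1' d2'].
have l1 x y : lft u1 x y -> lft v1 (f x) (f y).
  move=> lxy; have [x1 y1] := lft_in lxy.
  have := l x y; rewrite /= lxy !orbT => /(_ isT).
  rewrite e2 (negPf (d1 _ y1)) andbF /= => /orP[//|/lft_in[]].
  by rewrite e2 (negPf (d1 _ x1)).
have l2 x y : lft u2 x y -> lft v2 (f x) (f y).
  move=> lxy; have [x2 y2] := lft_in lxy.
  have := l x y; rewrite /= lxy !orbT => /(_ isT).
  rewrite e1 (negPf (d2 _ x2)) /= => /orP[/lft_in[]|//].
  by rewrite e1 (negPf (d2 _ x2)).
by rewrite (IH1 v1 n1 n1' e1 tp1 l1) (IH2 v2 n2 n2' e2 tp2 l2).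
Qed.

(** By [beforeE] the relation is expressed by images alone, and [f] carries these over. *)
Lemma before_transport us us' x y :
  uniq (labels us) -> uniq (labels us') -> fills us -> fills us' ->
  (forall x, (f x \in labels us') = (x \in labels us)) -> cpres us us' ->
  before us' (f x) (f y) = before us x y.
Proof.
move=> n1 n2 f1 f2 e cp.
have [/andP[xu yu]|no] := boolP ((x \in labels us) && (y \in labels us)); last first.
  apply/idP/idP=> /before_in[]; rewrite ?e => xu yu; by rewrite xu yu in no.
have [->|xy] := eqVneq x y.
  have irr vs z : uniq (labels vs) -> before vs z z = false.
    elim: vs => //= v vs IH; rewrite labels_cons => /cat_uniqP[_ nn d1 _].
    by rewrite IH // orbF; apply/andP=> -[/d1/negP].
  by rewrite !irr.
have xy' : f x != f y by rewrite inj_eq.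
have H d : chit us us [set x; y] x d = chit us' us' [set f x; f y] (f x) (f d).
  by rewrite (cp _ _ d (sub2 xu yu)) ?set21 // imsetU1 imset_set1.
have H1 d : chit us us [set x] x d = chit us' us' [set f x] (f x) (f d).
  by rewrite (cp [set x]) ?set11 ?imset_set1 // => z; rewrite inE => /eqP->.
apply/(beforeE n2 f2 _ _ xy')/(beforeE n1 f1 xu yu xy); rewrite ?e // => h d.
  by rewrite H H1.
by rewrite -(gK d) -H -H1.
Qed.

(** For the tails, a leaf of the first tree is added to [S], as in [fills_tail]. *)
Lemma cpres_cons u us u' us' :
  uniq (labels (u :: us)) -> uniq (labels (u' :: us')) ->
  (forall x, (f x \in leaves u') = (x \in leaves u)) ->
  (forall x, (f x \in labels us') = (x \in labels us)) ->
  cpres (u :: us) (u' :: us') -> tpres u u' /\ cpres us us'.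
Proof.
rewrite !labels_cons => /cat_uniqP[_ _ d1 d2] /cat_uniqP[_ _ d1' d2'] e1 e2 cp.
split=> S c d Ss cS.
  have := cp S c d _ cS.
  rewrite /= (_ : meets _ u); last by apply/meetsP; exists c; rewrite ?Ss.
  rewrite (_ : meets _ u'); last first.
    by apply/meetsP; exists (f c); rewrite ?e1 ?Ss // mem_imset.
  rewrite !chit_notin ?e2 ?d1 ?Ss // !orbF; apply.
  by move=> x /Ss xu; rewrite labels_cons mem_cat xu.
have [z zu] := leaf_ex u.
have := cp (z |: S) c d _ (setU1r _ cS).
rewrite /= (_ : meets _ u); last by apply/meetsP; exists z; rewrite ?setU11.
rewrite (_ : meets _ u'); last first.
  by apply/meetsP; exists (f z); rewrite ?e1 // mem_imset // setU11.
rewrite !hit_notin ?e1 ?d2 ?Ss //= => h.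
rewrite (@chit_ext _ _ S (z |: S)) ?h; first last.
- by move=> x xu; rewrite !inE; case: eqP => // xz; move: (d1 _ zu); rewrite -xz xu.
- by move=> x; rewrite !inE labels_cons mem_cat => /orP[/eqP->|/Ss->]; rewrite ?zu ?orbT.
apply: chit_ext => x xu; rewrite imsetU1 !inE; case: eqP => //= xz.
by move: xu; rewrite xz e2 (negPf (d1 _ zu)).
Qed.

(** The leaves of the first tree are those with nothing [before] them, so [f] matches the first
    trees, and then the tails by induction. *)
Lemma chain_transport us us' :
  uniq (labels us) -> uniq (labels us') -> fills us -> fills us' ->
  (forall x, (f x \in labels us') = (x \in labels us)) -> cpres us us' ->
  (forall x y, clft us x y -> clft us' (f x) (f y)) -> us' = map (tmap f) us.
Proof.
elim: us us' => [|u us IH] [|u' us'] n1 n2 f1 f2 e cp l //.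
- have [x xu] := leaf_ex u'.
  by have := e (g x); rewrite gK labels_cons mem_cat xu.
- have [x xu] := leaf_ex u.
  by have := e x; rewrite labels_cons mem_cat xu.
have b x y := before_transport x y n1 n2 f1 f2 e cp.
have [/cat_uniqP[nu nus d1 d2] /cat_uniqP[nu' nus' d1' d2']] := (n1, n2).
have nb v vs x y : (forall z, z \in leaves v -> z \notin labels vs) ->
  y \in leaves v -> before (v :: vs) x y = false.
  by move=> d yv /=; apply/negP=> /orP[/andP[_]|/before_in[_]]; rewrite (negPf (d _ yv)).
have e1 x : (f x \in leaves u') = (x \in leaves u).
  apply/idP/idP=> xu.
    have : x \in labels (u :: us) by rewrite -e labels_cons mem_cat xu.
    rewrite labels_cons mem_cat => /orP[//|xus].
    have [z zu] := leaf_ex u.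
    have := b z x; rewrite (nb u' us' (f z) (f x)) //.
    by rewrite /= zu xus.
  have : f x \in labels (u' :: us') by rewrite e labels_cons mem_cat xu.
  rewrite labels_cons mem_cat => /orP[//|xus].
  have [z zu] := leaf_ex u'.
  have := b (g z) x; rewrite (nb u us _ x) // gK.
  by rewrite /= zu xus.
have e2 x : (f x \in labels us') = (x \in labels us).
  have := e x; rewrite !labels_cons !mem_cat e1.
  case xu: (x \in leaves u) => //= _.
  by rewrite (negPf (d1' (f x) _)) ?e1 // (negPf (d1 x _)).
have [tp cp'] := cpres_cons n1 n2 e1 e2 cp.
have l1 x y : lft u x y -> lft u' (f x) (f y).
  move=> lxy; have [x1 y1] := lft_in lxy.
  have := l x y; rewrite /= lxy => /(_ isT) /orP[//|/clft_in[]].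
  by rewrite e2 (negPf (d1 _ x1)).
have l2 x y : clft us x y -> clft us' (f x) (f y).
  move=> lxy; have [x1 y1] := clft_in lxy.
  have := l x y; rewrite /= lxy orbT => /(_ isT) /orP[/lft_in[]|//].
  by rewrite e1 (negPf (d2 _ x1)).
by rewrite (tree_transport nu nu' e1 tp l1)
  (IH us' nus nus' (fills_tail n1 f1) (fills_tail n2 f2) e2 cp' l2).
Qed.

End Transport.

(** Either all the trees are copied or all are reflected, which is the alternative in clauses (i)
    and (ii) of the theorem. *)
Definition alike us us' :=
  map (@shape L) us' = map (@shape L) us \/
  map (@shape L) us' = map (@mirror unit) (map (@shape L) us).

Lemma fills_mirror us : fills us -> fills (map (@mirror L) us).
Proof.
move=> fi S c Ss cS; have [|d h] := fi S c _ cS; last by exists d; rewrite chit_mirror.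
by move=> x /Ss; rewrite labels_mirror.
Qed.

Lemma shape_mirror us : map (@shape L) (map (@mirror L) us) = map (@mirror unit) (map (@shape L) us).
Proof. by rewrite -!map_comp; apply: eq_map => u /=; rewrite /shape tmap_mirror. Qed.

Lemma map_shape_tmap (f : L -> L) us : map (@shape L) (map (tmap f) us) = map (@shape L) us.
Proof. by rewrite -map_comp; apply: eq_map => u /=; rewrite shape_tmap. Qed.

(* Any pair of leaves of one tree of a chain goes to the two children of the  *)
(* root of its first tree, so one choice of orientation rules all the trees.  *)
Lemma chain_alike f g us us' : cancel f g -> cancel g f ->
  uniq (labels us) -> uniq (labels us') -> fills us -> fills us' ->
  (forall x, (f x \in labels us') = (x \in labels us)) -> cpres f us us' ->
  alike us us'.
Proof.
move=> fK gK n1 n2 f1 f2 e cp; have fI := can_inj fK.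
(* The leaves of the two halves of the first tree. Any pair inside one tree of the chain is sent
   onto these two sets. *)
pose sn vs : seq L := if vs is Nd t1 _ :: _ then leaves t1 else [::].
pose dn vs : seq L := if vs is Nd _ t2 :: _ then leaves t2 else [::].
have sE vs x y d : uniq (labels vs) -> clft vs x y ->
  chit vs vs [set x; y] x d = (d \in sn vs) /\ chit vs vs [set x; y] y d = (d \in dn vs).
  by case: vs => // -[a|t1 t2] ts nn l; have := chit2_clft _ _ d nn l.
(* The images of two cells of one tree lie in one tree, and the order of the pair decides which half
   of the first tree of [us'] corresponds to [sn us]. That half is independent of the pair. *)
have key x y : clft us x y ->
  if clft us' (f x) (f y) then forall d, (f d \in sn us') = (d \in sn us)
  else clft us' (f y) (f x) /\ forall d, (f d \in dn us') = (d \in sn us).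
  move=> l; have [xu yu] := clft_in l; have xy := clft_neq n1 l.
  have H d : (d \in sn us) = chit us' us' [set f x; f y] (f x) (f d).
    have [<- _] := sE _ x y d n1 l.
    by rewrite (cp _ _ _ (sub2 xu yu)) ?set21 // imsetU1 imset_set1.
  have [l'|nl'] := ifPn; first by move=> d; rewrite H; have [->] := sE _ _ _ (f d) n2 l'.
  suff l' : clft us' (f y) (f x).
    by split=> // d; rewrite H setUC; have [_ ->] := sE _ _ _ (f d) n2 l'.
  have := @label_cases us' (f x) (f y); rewrite !e (inj_eq fI) => cases.
  case: (cases xu yu xy) => // b; last by rewrite b in nl'.
  (* Otherwise [x] and [y] would lie in different trees, and the nonempty image of [y] would be both
     in the first tree and in the second. *)
  - move: b; rewrite (before_transport fK gK _ _ n1 n2 f1 f2 e cp) => b.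
    have [z zP] := f1 [set x; y] y (sub2 xu yu) (set22 x y).
    have := zP; have [_ ->] := sE _ x y z n1 l.
    case: us n1 b l {sE xu yu cp e f1 f2 H cases} zP => // t ts n1 b l.
    have [_ ->] := chit2_before t ts z n1 b.
    case: ts n1 {b l} => // t2 ts; rewrite !labels_cons => /cat_uniqP[_ _ d1 d2].
    move=> zt; case: t d1 d2 => // t1 t3 d1 d2 /= zt3.
    by have := d1 z; rewrite /= !mem_cat zt3 zt orbT => /(_ isT).
  - move: b; rewrite (before_transport fK gK _ _ n1 n2 f1 f2 e cp) => b.
    have [z zP] := f1 [set x; y] x (sub2 xu yu) (set21 x y).
    have := zP; have [-> _] := sE _ x y z n1 l.
    rewrite setUC in zP.
    case: us n1 b l {sE xu yu cp e f1 f2 H cases} zP => // t ts n1 b l.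
    have [_ ->] := chit2_before t ts z n1 b.
    case: ts n1 {b l} => // t2 ts; rewrite !labels_cons => /cat_uniqP[_ _ d1 d2].
    move=> zt; case: t d1 d2 => // t1 t3 d1 d2 /= zt3.
    by have := d1 z; rewrite /= !mem_cat zt3 zt => /(_ isT).
(* A single test decides the orientation for the whole chain. *)
have [/forallP P|/forallPn[d0 P]] := boolP [forall d, (f d \in sn us') == (d \in sn us)].
  left; rewrite (chain_transport fK gK n1 n2 f1 f2 e cp) ?map_shape_tmap // => x y l.
  have := key x y l; case: ifP => // _ [l' Q].
  (* A reversed pair would give the two halves [sn us'] and [dn us'] a common leaf. *)
  have [z] := f2 [set f y; f x] (f y) (sub2 (proj1 (clft_in l')) (proj2 (clft_in l'))) (set21 _ _).
  have [-> _] := sE us' _ _ z n2 l'.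
  have := eqP (P (g z)); rewrite -Q gK => sd zs; move: (zs); rewrite sd => zd; exfalso.
  move: (us') n2 zs zd; rewrite /sn /dn => -[|[?|t1 t2] ?] //; rewrite labels_cons.
  by case/cat_uniqP=> /cat_uniqP[_ _ h _] _ _ _ /h/negPf->.
(* Now every pair is reversed, so reflecting [us'] leads back to the order-preserving case. *)
right; rewrite -[us']( mapK (@mirrorK L)) shape_mirror; congr map.
rewrite (@chain_transport f g fK gK us (map (@mirror L) us')) ?map_shape_tmap //.
- by rewrite uniq_labels_mirror.
- exact: fills_mirror.
- by move=> x; rewrite labels_mirror.
- by move=> S c d Ss cS; rewrite chit_mirror cp.
move=> x y l; rewrite clft_mirror; have := key x y l; case: ifP => [_ Q|_ []//].
by rewrite Q eqxx in P.
Qed.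

(* [us] hangs on the left spine and [vs] on the right one. *)
Definition whit us vs S c d : bool := chit us us S c d || chit vs vs S c d.

Definition wfills us vs := forall S c, {subset S <= labels us ++ labels vs} ->
  c \in S -> exists d, whit us vs S c d.

Definition linked (f : L -> L) us vs us' vs' := forall S c d,
  {subset S <= labels us ++ labels vs} -> c \in S ->
  whit us vs S c d = whit us' vs' (f @: S) (f c) (f d).

Lemma whitC us vs S c d : whit us vs S c d = whit vs us S c d.
Proof. exact: orbC. Qed.

Lemma mem_catC (s t : seq L) : s ++ t =i t ++ s.
Proof. by move=> x; rewrite !mem_cat orbC. Qed.

Lemma wfillsC us vs : wfills us vs -> wfills vs us.
Proof.
move=> w S c Ss cS; have [|d h] := w S c _ cS; last by exists d; rewrite whitC.
by move=> x /Ss; rewrite mem_catC.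
Qed.

Lemma linkedC f us vs us' vs' : linked f us vs us' vs' -> linked f vs us vs' us'.
Proof.
move=> l S c d Ss cS; rewrite whitC [RHS]whitC.
by apply: l => // x xS; rewrite mem_catC; apply: Ss.
Qed.

Lemma linkedCr f us vs us' vs' : linked f us vs us' vs' -> linked f us vs vs' us'.
Proof. by move=> l S c d Ss cS; rewrite (l S c d Ss cS) whitC. Qed.

Lemma whit_right us vs S c d : uniq (labels us ++ labels vs) -> c \in labels vs ->
  whit us vs S c d = chit vs vs S c d.
Proof.
by case/cat_uniqP=> _ _ _ d2 cv; rewrite /whit chit_notin ?d2.
Qed.

(* Singletons detect the sides: they send their cell onto the first tree. *)
Lemma whit1 us vs x y : uniq (labels us ++ labels vs) ->
  x \in labels vs -> y \in labels us ++ labels vs ->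
  (forall d, whit us vs [set x] x d = whit us vs [set y] y d) <-> y \in labels vs.
Proof.
have c1 ws z d : uniq (labels ws) -> z \in labels ws ->
  chit ws ws [set z] z d = (if ws is t :: _ then d \in leaves t else false).
  by case: ws => // t ts nn zt; apply: chit1 => // w _; rewrite inE.
move=> nn xv yuv; have [nu nv d1 d2] := cat_uniqP nn; split=> [h|yv d]; last first.
  by rewrite !whit_right // !c1.
move: yuv; rewrite mem_cat => /orP[yu|//].
case: vs xv nn nv d1 d2 h => // t ts xv nn nv d1 d2 h.
have [z zt] := leaf_ex t.
have := h z; rewrite whit_right // c1 // zt whitC whit_right // 1?uniq_catC // c1 //.
case: us yu nu nn d1 d2 {h} => // u us _ _ _ d1 _ /esym zu.
by have := d1 z; rewrite !labels_cons !mem_cat zu zt => /(_ isT).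
Qed.

(** When [S] lies on one spine the other spine contributes nothing, so the problem restricts to a
    problem about single chains. *)
Lemma half_alike f g us vs us' vs' : cancel f g -> cancel g f ->
  uniq (labels us ++ labels vs) -> uniq (labels us' ++ labels vs') ->
  wfills us vs -> wfills us' vs' -> linked f us vs us' vs' ->
  (forall x, (f x \in labels vs') = (x \in labels vs)) -> alike vs vs'.
Proof.
move=> fK gK n1 n2 f1 f2 l e.
have [[_ nv _ _] [_ nv' _ _]] := (cat_uniqP n1, cat_uniqP n2).
have sub ws ws' S : {subset S <= labels ws'} -> {subset S <= labels ws ++ labels ws'}.
  by move=> Ss x /Ss xu; rewrite mem_cat xu orbT.
apply: (chain_alike fK gK) => //.
- move=> S c Ss cS; have [d] := f1 S c (sub _ _ _ Ss) cS.
  by rewrite whit_right ?Ss //; exists d.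
- move=> S c Ss cS; have [d] := f2 S c (sub _ _ _ Ss) cS.
  by rewrite whit_right ?Ss //; exists d.
move=> S c d Ss cS; have := l S c d (sub _ _ _ Ss) cS.
by rewrite !whit_right // ?e ?Ss.
Qed.

(** By [whit1], two cells are on the same spine iff their singletons have the same image, a
    condition preserved by [f]. The one cell [x0] therefore decides for all. *)
Lemma linked_side f us vs us' vs' x0 :
  injective f -> (forall d', exists d, d' = f d) ->
  uniq (labels us ++ labels vs) -> uniq (labels us' ++ labels vs') ->
  linked f us vs us' vs' ->
  (forall x, (f x \in labels us' ++ labels vs') = (x \in labels us ++ labels vs)) ->
  x0 \in labels vs -> f x0 \in labels vs' ->
  forall x, (f x \in labels vs') = (x \in labels vs).
Proof.
move=> fI fS n1 n2 l e x0v x0v' x.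
have [xuv|xuv] := boolP (x \in labels us ++ labels vs); last first.
  have := xuv; rewrite -e => xuv'.
  rewrite !mem_cat !negb_or in xuv xuv'.
  by case/andP: xuv => _ /negPf->; case/andP: xuv' => _ /negPf->.
have H z d : z \in labels us ++ labels vs ->
    whit us vs [set z] z d = whit us' vs' [set f z] (f z) (f d).
  by move=> zi; rewrite (l [set z]) ?set11 ?imset_set1 // => w; rewrite inE => /eqP->.
have x0i : x0 \in labels us ++ labels vs by rewrite mem_cat x0v orbT.
have xuv' : f x \in labels us' ++ labels vs' by rewrite e.
apply/idP/idP=> h.
  apply: (proj1 (whit1 n1 x0v xuv)) => d; rewrite (H x0 _ x0i) (H x _ xuv).
  exact: (proj2 (whit1 n2 x0v' xuv') h (f d)).
apply: (proj1 (whit1 n2 x0v' xuv')) => d'; have [d ->] := fS d'.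
rewrite -(H x0 _ x0i) -(H x _ xuv); exact: (proj2 (whit1 n1 x0v xuv) h d).
Qed.

Lemma other_side f us vs us' vs' :
  uniq (labels us ++ labels vs) -> uniq (labels us' ++ labels vs') ->
  (forall x, (f x \in labels us' ++ labels vs') = (x \in labels us ++ labels vs)) ->
  (forall x, (f x \in labels vs') = (x \in labels vs)) ->
  forall x, (f x \in labels us') = (x \in labels us).
Proof.
case/cat_uniqP=> _ _ d1 d2 /cat_uniqP[_ _ d1' d2'] e ev x.
have := e x; rewrite !mem_cat ev; case: (boolP (x \in labels vs)) => [xv _|]; last by rewrite !orbF.
by rewrite (negPf (d2 _ xv)) (negPf (d2' _ _)) ?ev.
Qed.

Theorem linked_alike f g us vs us' vs' : cancel f g -> cancel g f ->
  uniq (labels us ++ labels vs) -> uniq (labels us' ++ labels vs') ->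
  wfills us vs -> wfills us' vs' -> linked f us vs us' vs' ->
  (forall x, (f x \in labels us' ++ labels vs') = (x \in labels us ++ labels vs)) ->
  (alike vs vs' /\ alike us us') \/ (alike vs us' /\ alike us vs').
Proof.
move=> fK gK n1 n2 f1 f2 l e; have fI := can_inj fK.
have fS d' : exists d, d' = f d by exists (g d').
(* A spine may carry no cell. Up to exchanging the spines, [vs] provides the test cell, unless there
   are no cells at all. *)
wlog : us vs n1 f1 l e / (exists x, x \in labels vs) \/ forall x, x \notin labels us ++ labels vs.
  move=> W.
  have [v|nv] := boolP [exists x, x \in labels vs].
    by apply: W => //; left; apply/existsP.
  have [u|nu] := boolP [exists x, x \in labels us].
    have n1' := n1; rewrite uniq_catC in n1'.
    case: (W _ _ n1' (wfillsC f1) (linkedCr (linkedCr (linkedC (linkedCr l))))).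
    - by move=> x; rewrite e mem_catC.
    - by left; apply/existsP.
    - by case; right.
    - by case; left.
  apply: W => //; right=> x; rewrite mem_cat negb_or.
  by move/existsPn: nv => ->; move/existsPn: nu => ->.
case=> [[x0 x0v]|none]; last first.
  have sE x : (x \in labels us ++ labels vs) = false by rewrite (negPf (none x)).
  have sE' x : (x \in labels us' ++ labels vs') = false by have [y ->] := fS x; rewrite e sE.
  have nil ws ws' : (forall x, (x \in labels ws ++ labels ws') = false) -> ws = [::] /\ ws' = [::].
    move=> h; split.
      case: ws h => // t ts h; have [z zt] := leaf_ex t.
      by have := h z; rewrite labels_cons !mem_cat zt.
    case: ws' h => // t ts h; have [z zt] := leaf_ex t.
    by have := h z; rewrite labels_cons !mem_cat zt !orbT.
  have [-> ->] := nil _ _ sE; have [-> ->] := nil _ _ sE'.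
  by left; split; left.
have : f x0 \in labels us' ++ labels vs' by rewrite e mem_cat x0v orbT.
rewrite mem_cat => /orP[x0u'|x0v'].
  right; have n2' := n2; rewrite uniq_catC in n2'.
  have e' x : (f x \in labels vs' ++ labels us') = (x \in labels us ++ labels vs).
    by rewrite mem_catC e.
  have ev := linked_side fI fS n1 n2' (linkedCr l) e' x0v x0u'.
  have eu := other_side n1 n2' e' ev.
  split; first exact: (half_alike fK gK n1 n2' f1 (wfillsC f2) (linkedCr l) ev).
  rewrite uniq_catC in n1.
  exact: (half_alike fK gK n1 n2 (wfillsC f1) f2 (linkedCr (linkedC l)) eu).
left; have ev := linked_side fI fS n1 n2 l e x0v x0v'.
have eu := other_side n1 n2 e ev.
split; first exact: (half_alike fK gK n1 n2 f1 f2 l ev).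
rewrite uniq_catC in n1; rewrite uniq_catC in n2.
exact: (half_alike fK gK n1 n2 (wfillsC f1) (wfillsC f2) (linkedC l) eu).
Qed.

(** * Building a bijection of leaves from equal shapes *)

Lemma relabel (s s' : seq L) : uniq s -> uniq s' -> size s = size s' -> s =i s' ->
  exists f g : L -> L, [/\ cancel f g, cancel g f & map f s = s'].
Proof.
move=> n1 n2 ss e.
have h (p q : seq L) : uniq p -> uniq q -> size p = size q -> p =i q ->
    cancel (fun x => nth x q (index x p)) (fun x => nth x p (index x q)).
  move=> np nq pq epq x /=; have [xp|xp] := boolP (x \in p).
    have iq : index x p < size q by rewrite -pq index_mem.
    by rewrite index_uniq // (set_nth_default x) ?pq // nth_index.
  have np' : size q <= index x p by rewrite -pq leqNgt index_mem.
  rewrite (nth_default _ np') nth_default // pq leqNgt index_mem -epq //.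
(* The default [x] makes both maps the identity outside the lists, hence bijections of the whole
   type. *)
exists (fun x => nth x s' (index x s)), (fun x => nth x s (index x s')).
split; [exact: h | by apply: h => // x; rewrite e |].
case: s s' n1 n2 ss e {h} => [|x0 s] s' n1 n2 ss e; first by case: s' ss {n2 e}.
apply: (@eq_from_nth _ x0) => [|i]; rewrite size_map // => ik.
by rewrite (nth_map x0) // index_uniq // (set_nth_default x0) // -ss.
Qed.

Lemma size_shape u u' : shape u = shape u' -> size (leaves u) = size (leaves u').
Proof.
rewrite /shape; elim: u u' => [?|? IH1 ? IH2] [?|? ?] //= [/IH1 h1 /IH2 h2].
by rewrite !size_cat h1 h2.
Qed.

Lemma tmap_of_shape (f : L -> L) u u' : shape u = shape u' ->
  map f (leaves u) = leaves u' -> u' = tmap f u.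
Proof.
elim: u u' => [a|u1 IH1 u2 IH2] [b|v1 v2] //= => [_ [->] //|].
case=> s1 s2; rewrite map_cat => /eqP; rewrite eqseq_cat ?size_map ?(size_shape s1) //.
by case/andP=> /eqP/(IH1 _ s1)-> /eqP/(IH2 _ s2)->.
Qed.

Lemma map_tmap_of_shape (f : L -> L) us us' : map (@shape L) us = map (@shape L) us' ->
  map f (labels us) = labels us' -> us' = map (tmap f) us.
Proof.
elim: us us' => [|u us IH] [|u' us'] //= [s1 s2]; rewrite !labels_cons map_cat => /eqP.
rewrite eqseq_cat ?size_map ?(size_shape s1) //.
by case/andP=> /eqP/(tmap_of_shape s1)-> /eqP/(IH _ s2)->.
Qed.

Lemma alike_size us us' : alike us us' -> size (labels us) = size (labels us').
Proof.
have sz (w : btree unit) : size (leaves (mirror w)) = size (leaves w).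
  by elim: w => //= w1 h1 w2 h2; rewrite !size_cat h1 h2 addnC.
have lE vs : size (labels vs) = sumn (map (fun w => size (leaves w)) (map (@shape L) vs)).
  by elim: vs => //= v vs IH; rewrite labels_cons size_cat IH /shape leaves_tmap size_map.
by rewrite !lE => -[->|->] //; rewrite -[in RHS]map_comp; congr sumn; apply/esym/eq_map=> w /=; rewrite sz.
Qed.

(** Each target chain may be reflected as a whole without changing [chit], so the shapes may be
    assumed equal. Matching the leaves in order is then a relabelling, and [chit_map] applies. *)
Theorem alike_linked us vs us' vs' :
  uniq (labels us ++ labels vs) -> uniq (labels us' ++ labels vs') ->
  labels us ++ labels vs =i labels us' ++ labels vs' ->
  alike us us' -> alike vs vs' ->
  exists f g : L -> L, [/\ cancel f g, cancel g f,
    forall x, (f x \in labels us' ++ labels vs') = (x \in labels us ++ labels vs)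
    & linked f us vs us' vs'].
Proof.
move=> n1 n2 e au av.
have norm (ws ws' : seq (btree L)) : uniq (labels ws') -> alike ws ws' -> exists ws'',
  [/\ map (@shape L) ws = map (@shape L) ws'', uniq (labels ws''), labels ws'' =i labels ws',
      size (labels ws'') = size (labels ws')
   & forall S c d, chit ws'' ws'' S c d = chit ws' ws' S c d].
  move=> nn [h|h]; first by exists ws'.
  exists (map (@mirror L) ws'); split=> [||||S c d]; last exact: chit_mirror.
  - by rewrite shape_mirror h (mapK (@mirrorK unit)).
  - by rewrite uniq_labels_mirror.
  - exact: labels_mirror.
  - by apply/eqP; rewrite eq_sym; apply/eqP/alike_size; right; rewrite shape_mirror.
have [nu nv du dv] := cat_uniqP n2.
have [u2 [su qu eu zu cu]] := norm _ _ nu au.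
have [v2 [sv qv ev zv cv]] := norm _ _ nv av.
have [||||f [g [fK gK fm]]] := @relabel (labels us ++ labels vs) (labels u2 ++ labels v2).
- by [].
- rewrite cat_uniq qu qv andbT /=; apply/hasPn=> x; rewrite /= eu ev; exact: dv.
- by rewrite !size_cat zu zv (alike_size au) (alike_size av).
- by move=> x; rewrite e !mem_cat eu ev.
exists f, g; split=> // [x|S c d _ _].
  have -> : labels us' ++ labels vs' =i labels u2 ++ labels v2 by move=> y; rewrite !mem_cat eu ev.
  by rewrite -fm mem_map //; apply: can_inj fK.
have fI := can_inj fK.
have szu : size (map f (labels us)) = size (labels u2) by rewrite size_map zu (alike_size au).
move: fm; rewrite map_cat => /eqP; rewrite eqseq_cat // => /andP[/eqP fu /eqP fv].
have u2E := map_tmap_of_shape su fu; have v2E := map_tmap_of_shape sv fv.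
by rewrite /whit -!cu -!cv u2E v2E !chit_map.
Qed.

End Hit.

(** * Order-preserving trees *)

Section OrderTree.
Variables (n : nat) (T : tree 'I_n.+1).
Local Notation point := 'I_n.+1.
Hypothesis hT : order_preserving T.
Implicit Types (x y v m : point) (G : {set point}).

Definition convex G := forall x y z : point, x \in G -> z \in G -> x <= y <= z -> y \in G.

Lemma desc_child (V : finType) (U : tree V) (x y : V) : desceq U x y -> x = y \/ exists2 c, child U x c & desceq U c y.
Proof.
case/connectP=> -[|c p] /=; first by left.
by case/andP=> xc cp yE; right; exists c => //; apply/connectP; exists p.
Qed.

Lemma child_cases (V : finType) (U : tree V) (x c : V) : child U x c -> son U x = Some c \/ dau U x = Some c.
Proof. by case/orP=> /eqP; [left|right]. Qed.

Lemma son_child (V : finType) (U : tree V) (x c : V) : son U x = Some c -> child U x c.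
Proof. by move=> h; rewrite /child h eqxx. Qed.

Lemma dau_child (V : finType) (U : tree V) (x c : V) : dau U x = Some c -> child U x c.
Proof. by move=> h; rewrite /child h eqxx orbT. Qed.

Lemma desc_refl (V : finType) (U : tree V) (x : V) : desceq U x x.
Proof. exact: connect0. Qed.

Lemma desc_trans (V : finType) (U : tree V) (x y z : V) : desceq U x y -> desceq U y z -> desceq U x z.
Proof. exact: connect_trans. Qed.

Lemma desc1 (V : finType) (U : tree V) (x y : V) : child U x y -> desceq U x y.
Proof. exact: connect1. Qed.

Lemma son_lt x s y : son T x = Some s -> desceq T s y -> y < x.
Proof. by case: hT => _ _ h _; apply: h. Qed.

Lemma dau_gt x s y : dau T x = Some s -> desceq T s y -> x < y.
Proof. by case: hT => _ _ _ h; apply: h. Qed.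

Lemma child_strict x c : child T x c -> ~~ desceq T c x.
Proof.
by case/child_cases=> h; apply/negP=> /[dup] cx;
  [move/(son_lt h)|move/(dau_gt h)]; rewrite ltnn.
Qed.

Lemma desc_anti x y : desceq T x y -> desceq T y x -> x = y.
Proof.
move=> /[dup] xy /desc_child[//|[c xc cy]] yx.
by have := child_strict xc; rewrite (desc_trans cy yx).
Qed.

Lemma root_ex : exists r, rt T = Some r /\ forall y, desceq T r y.
Proof.
case: hT => _ vT _ _; case E: (rt T) => [r|]; last first.
  by have := in_setT (ord0 : point); rewrite -vT /verts E inE.
by exists r; split=> // y; have := in_setT y; rewrite -vT /verts E inE.
Qed.

Lemma highestP G m : highest T G = Some m -> m \in G /\ forall y, y \in G -> desceq T m y.
Proof.
rewrite /highest; case: pickP => // z /andP[zG /forall_inP h] [<-].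
by split.
Qed.

Lemma highestE G m : m \in G -> (forall y, y \in G -> desceq T m y) -> highest T G = Some m.
Proof.
move=> mG h; rewrite /highest; case: pickP => [z /andP[zG /forall_inP hz]|].
  by congr Some; apply: desc_anti; [apply: hz|apply: h].
by move/(_ m); rewrite mG /= => /negP; case; apply/forall_inP.
Qed.

(** Descend from the root: a vertex outside the convex set has all of it on one side, hence below
    one child. *)
Lemma highest_ex G x0 : x0 \in G -> convex G -> exists m, highest T G = Some m.
Proof.
move=> x0G cG.
suff [m mG h] : exists2 m, m \in G & forall y, y \in G -> desceq T m y.
  by exists m; apply: highestE.
have [r [_ hr]] := root_ex.
have : forall y, y \in G -> desceq T r y by [].
move: {2}#|_| (leqnn #|[set y | desceq T r y]|) => k; elim: k r {hr} => [|k IH] v.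
  by rewrite leqn0 cards_eq0 => /eqP/setP/(_ v); rewrite !inE desc_refl.
move=> vk vG; have [vin|vnin] := boolP (v \in G); first by exists v.
have step c : child T v c -> (forall y, y \in G -> desceq T c y) ->
    exists2 m, m \in G & forall y, y \in G -> desceq T m y.
  move=> vc cG'; apply: (IH c) => //; rewrite -ltnS; apply: leq_trans vk.
  apply: proper_card; apply/properP; split.
    by apply/subsetP=> y; rewrite !inE; apply: desc_trans; apply: desc1.
  by exists v; rewrite !inE ?desc_refl // child_strict.
have side y : y \in G -> (y < v) = (x0 < v).
  move=> yG; apply/idP/idP=> lt; rewrite ltnNge; apply/negP=> ge;
   case/negP: vnin; [apply: (cG y _ x0)|apply: (cG x0 _ y)] => //;
   by rewrite ge ltnW.
have ex y : y \in G -> exists2 c, child T v c & desceq T c y.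
  by move=> yG; have [vy|//] := desc_child (vG y yG); rewrite vy yG in vnin.
have [c0 vc0 c0x] := ex _ x0G.
apply: (step c0) => // y yG; have [c vc cy] := ex y yG.
have := side y yG.
case/child_cases: vc0 (vc0) => h0 vc0; case/child_cases: vc => h.
- by move: h; rewrite h0 => -[->].
- by rewrite (son_lt h0 c0x) => /ltn_trans/(_ (dau_gt h cy)); rewrite ltnn.
- by rewrite (son_lt h cy) => /esym/ltn_trans/(_ (dau_gt h0 c0x)); rewrite ltnn.
- by move: h; rewrite h0 => -[->].
Qed.

Lemma highest_none G : convex G -> highest T G = None -> G = set0.
Proof.
move=> cG h; apply/setP=> x; rewrite inE; apply/negbTE/negP=> xG.
by have [m] := highest_ex xG cG; rewrite h.
Qed.

Definition gap x y : {set point} := [set p : point | x < p < y].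
Definition above x : {set point} := [set p : point | x < p].
Definition under y : {set point} := [set p : point | p < y].

Lemma gap_convex x y : convex (gap x y).
Proof.
move=> a b c; rewrite !inE => /andP[xa _] /andP[_ cy] /andP[ab bc].
by rewrite (leq_trans xa ab) (leq_ltn_trans bc cy).
Qed.
Lemma above_convex x : convex (above x).
Proof. by move=> a b c; rewrite !inE => xa _ /andP[ab _]; apply: leq_trans ab. Qed.
Lemma under_convex x : convex (under x).
Proof. by move=> a b c; rewrite !inE => _ xa /andP[_ bc]; apply: leq_ltn_trans xa. Qed.

(** The right end of the cell [x]. At the last point, which is not a cell, the value is junk. *)
Definition cell_top (x : point) : point := inord x.+1.

Lemma cell_topE x : x < n -> cell_top x = x.+1 :> nat.
Proof. by move=> h; rewrite inordK. Qed.

(* [u] is the inner tree of the interval of cells between [x] and [y]. *)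
Fixpoint gap_tree x y (u : btree point) : Prop :=
  match u with
  | Lf c => c = x /\ highest T (gap x y) = None
  | Nd u1 u2 => exists m, [/\ highest T (gap x y) = Some m, gap_tree x m u1 & gap_tree m y u2]
  end.

Lemma gap_tree_ex x y : x < y -> exists u, gap_tree x y u.
Proof.
move: {2}(y - x) (leqnn (y - x)) => k; elim: k x y => [|k IH] x y hk xy.
  by rewrite leqn0 subn_eq0 leqNgt xy in hk.
case E: (highest T (gap x y)) => [m|]; last by exists (Lf x).
have [] := highestP E; rewrite inE => /andP[xm my] _.
have h1 : m - x <= k by rewrite -ltnS; apply: leq_trans hk; rewrite ltn_sub2r.
have h2 : y - m <= k by rewrite -ltnS; apply: leq_trans hk; rewrite ltn_sub2l.
have [[u1 hu1] [u2 hu2]] := (IH _ _ h1 xm, IH _ _ h2 my).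
by exists (Nd u1 u2), m.
Qed.

Lemma gap0 x y : highest T (gap x y) = None -> x < y -> y = x.+1 :> nat.
Proof.
move=> /(highest_none (@gap_convex x y))/setP h xy; apply/eqP; rewrite eqn_leq xy andbT leqNgt.
have ltn : x.+1 < n.+1 by apply: leq_ltn_trans xy _.
by have := h (Ordinal ltn); rewrite !inE /= ltnSn /= => ->.
Qed.

Lemma gap_tree_leaves x y u : gap_tree x y u -> x < y -> leaves u =i [pred c : point | x <= c < y].
Proof.
elim: u x y => [a|u1 IH1 u2 IH2] x y /=.
  move=> [-> /gap0 h] /h yE c; rewrite !inE yE ltnS.
  by rewrite -eqn_leq -val_eqE /= eq_sym.
move=> [m [/highestP[]]]; rewrite inE => /andP[xm my] _ /IH1 h1 /IH2 h2 xy c.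
rewrite mem_cat (h1 xm) (h2 my) !inE.
case: (ltnP c m) => cm /=; rewrite ?andbT ?andbF.
  by rewrite orbF (ltn_trans cm my) andbT.
by rewrite (leq_trans (ltnW xm) cm).
Qed.

Lemma gap_tree_uniq x y u : gap_tree x y u -> x < y -> uniq (leaves u).
Proof.
elim: u x y => //= u1 IH1 u2 IH2 x y.
move=> [m [/highestP[]]]; rewrite inE => /andP[xm my] _ h1 h2 xy.
rewrite cat_uniq (IH1 _ _ h1 xm) (IH2 _ _ h2 my) andbT /=.
apply/hasPn=> c; rewrite /= (gap_tree_leaves h1 xm) (gap_tree_leaves h2 my) !inE => /andP[mc _].
by apply/negP=> /andP[_]; rewrite ltnNge mc.
Qed.

(** A vertex of a spine with the inner tree of the gap between it and the preceding vertex. *)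
Definition entry := (point * btree point)%type.

(* The vertices below [x] on the right spine, with their left inner trees;    *)
(* [lchain] is the mirror image.                                              *)
Fixpoint rchain x (us : seq entry) : Prop :=
  if us is mu :: us' then
    [/\ highest T (above x) = Some mu.1, gap_tree x mu.1 mu.2 & rchain mu.1 us']
  else highest T (above x) = None.

Fixpoint lchain y (us : seq entry) : Prop :=
  if us is mu :: us' then
    [/\ highest T (under y) = Some mu.1, gap_tree mu.1 y mu.2 & lchain mu.1 us']
  else highest T (under y) = None.

Lemma rchain_ex x : exists us, rchain x us.
Proof.
move: {2}(n - x) (leqnn (n - x)) => k; elim: k x => [|k IH] x hk.
  exists [::] => /=; case E: (highest _ _) => [m|] //.
  have [] := highestP E; rewrite inE => xm _.
  by move: hk; rewrite leqn0 subn_eq0 leqNgt (leq_trans xm (leq_ord m)).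
case E: (highest T (above x)) => [m|]; last by exists [::].
have [] := highestP E; rewrite inE => xm _.
have [|us h] := IH m.
  by rewrite -ltnS; apply: leq_trans hk; rewrite ltn_sub2l // (leq_trans xm (leq_ord m)).
by have [u hu] := gap_tree_ex xm; exists ((m, u) :: us).
Qed.

Lemma lchain_ex x : exists us, lchain x us.
Proof.
move: {2}(x : nat) (leqnn x) => k; elim: k x => [|k IH] x hk.
  exists [::] => /=; case E: (highest _ _) => [m|] //.
  have [] := highestP E; rewrite inE => xm _.
  by move: xm; rewrite ltnNge (leq_trans hk).
case E: (highest T (under x)) => [m|]; last by exists [::].
have [] := highestP E; rewrite inE => xm _.
have [|us h] := IH m; first by rewrite -ltnS; apply: leq_trans hk.
by have [u hu] := gap_tree_ex xm; exists ((m, u) :: us).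
Qed.

Definition glabels (us : seq entry) := labels (map snd us).

Lemma rchain_top x : highest T (above x) = None -> x = n :> nat.
Proof.
move=> h; have /setP := highest_none (@above_convex x) h.
move=> /(_ ord_max); rewrite !inE => /negbT; rewrite -leqNgt => nx.
by apply/eqP; rewrite eqn_leq leq_ord.
Qed.

Lemma lchain_bot x : highest T (under x) = None -> x = 0 :> nat.
Proof.
move=> h; have /setP := highest_none (@under_convex x) h.
by move=> /(_ ord0); rewrite !inE lt0n => /negbFE/eqP.
Qed.

Lemma rchain_labels x us : rchain x us ->
  uniq (glabels us) /\ glabels us =i [pred c : point | x <= c < n].
Proof.
elim: us x => [|[m u] us IH] x /=.
  move=> /rchain_top xn; split=> // c; rewrite !inE xn.
  by case: (ltnP c n); rewrite ?andbF.
case=> /highestP[]; rewrite inE /= => xm _ hu /IH[nn e].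
rewrite /glabels /= labels_cons cat_uniq (gap_tree_uniq hu xm) nn andbT /=; split.
  apply/hasPn=> c; rewrite e /= (gap_tree_leaves hu xm) !inE => /andP[mc _].
  by apply/negP=> /andP[_]; rewrite ltnNge mc.
move=> c; rewrite mem_cat (gap_tree_leaves hu xm) e !inE.
case: (ltnP c m) => cm /=; rewrite ?andbT ?andbF ?(leq_trans (ltnW xm) cm) //.
by rewrite orbF (leq_trans cm (leq_ord m)) andbT.
Qed.

Lemma lchain_labels x us : lchain x us ->
  uniq (glabels us) /\ glabels us =i [pred c : point | c < x].
Proof.
elim: us x => [|[m u] us IH] x /=.
  by move=> /lchain_bot xn; split=> // c; rewrite !inE xn ltn0.
case=> /highestP[]; rewrite inE /= => xm _ hu /IH[nn e].
rewrite /glabels /= labels_cons cat_uniq (gap_tree_uniq hu xm) nn andbT /=; split.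
  apply/hasPn=> c; rewrite e /= (gap_tree_leaves hu xm) !inE => mc.
  by apply/negP=> /andP[]; rewrite leqNgt mc.
move=> c; rewrite mem_cat (gap_tree_leaves hu xm) e !inE.
by case: (ltnP c m) => cm /=; rewrite ?andbT ?andbF ?orbF ?(ltn_trans cm xm).
Qed.

(** * Images of cells under a natural monotone map *)

Section Map.
Variable phi : point -> point.
Hypothesis mono : forall x y : point, x <= y -> phi x <= phi y.
(** Supplied by [Phi_natural] for members of [Phi]. With [G] and [G'] a gap and its image gap, it
    carries the splitting point of the one to that of the other. *)
Hypothesis natural : forall G G' m, convex G' -> highest T G = Some m ->
  (forall x, phi x \in G' -> x \in G) -> phi m \in G' -> highest T G' = Some (phi m).

(* A cell is encoded by its left end. *)
Definition jumps : {set point} := [set c : point | (c < n) && (phi c < phi (cell_top c))].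

Lemma phi_lt x y : phi x < phi y -> x < y.
Proof. by rewrite !ltnNge; apply: contra => /mono. Qed.

Lemma cell_in (x c y : point) : x <= c < y -> [/\ phi x <= phi c, phi (cell_top c) <= phi y & c < n].
Proof.
case/andP=> xc cy; have cn : c < n by apply: leq_trans cy (leq_ord y).
by split=> //; apply: mono => //; rewrite cell_topE.
Qed.

Lemma no_jump (x y c d : point) : phi y <= phi x ->
  (x <= c < y) && (phi c <= d < phi (cell_top c)) = false.
Proof.
move=> le; apply/negP=> /andP[/cell_in[i1 i2 _] /andP[cd dc]].
have := leq_ltn_trans cd dc; rewrite ltnNge => /negP; apply.
exact: leq_trans i2 (leq_trans le i1).
Qed.

Lemma jump_ex x y : phi x < phi y -> exists2 c : point, x <= c < y & c \in jumps.
Proof.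
move=> lt; have xy := phi_lt lt.
move: {2}(y - x) (leqnn (y - x)) => k; elim: k x xy lt => [|k IH] x xy lt hk.
  by rewrite leqn0 subn_eq0 leqNgt xy in hk.
have xn : x < n by apply: leq_trans xy (leq_ord y).
have [j|] := ltnP (phi x) (phi (cell_top x)).
  by exists x; rewrite ?leqnn // inE xn.
move=> le; have lt' := leq_ltn_trans le lt; have := phi_lt lt'; rewrite cell_topE // => xy'.
have [|||c] := IH (cell_top x); rewrite ?cell_topE //.
  by rewrite -ltnS; apply: leq_trans hk; rewrite ltn_sub2l.
by case/andP=> xc cy cj; exists c => //; rewrite cy (ltnW xc).
Qed.

Lemma meets_gap_tree x y u : gap_tree x y u -> x < y -> meets jumps u = (phi x < phi y).
Proof.
move=> hu xy; apply/meetsP/idP => [[c]|/jump_ex[c cxy cj]]; last first.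
  by exists c => //; rewrite (gap_tree_leaves hu xy).
rewrite (gap_tree_leaves hu xy) !inE => /cell_in[h1 h2 h3] /andP[_ lt].
exact: leq_ltn_trans h1 (leq_trans lt h2).
Qed.

(** A half on which [phi] is constant has no jump and is skipped, while the other half has the same
    image gap as the whole. If neither half collapses, [phi m] lies strictly inside the image gap
    and [natural] makes it the point where [t] splits. *)
Lemma hit_gap_tree x y u t (c d : point) : gap_tree x y u -> gap_tree (phi x) (phi y) t ->
  x < y -> phi x < phi y ->
  hit u t jumps c d = (x <= c < y) && (phi c <= d < phi (cell_top c)).
Proof.
elim: u x y t => [a|u1 IH1 u2 IH2] x y t /=.
  move=> [-> h] ht xy lt; have yE := gap0 h xy.
  have xn : x < n by rewrite -ltnS -yE ltn_ord.
  have -> : (x <= c < y) = (c == x).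
    by rewrite yE ltnS -eqn_leq eq_sym.
  case: (c =P x) => //= ->; rewrite !inE xn /= (gap_tree_leaves ht lt) !inE.
  by rewrite (_ : cell_top x = y) ?lt //; apply: val_inj; rewrite /= cell_topE // yE.
move=> [m [hm h1 h2]] ht xy lt.
have [] := highestP hm; rewrite inE => /andP[xm my] _.
rewrite (meets_gap_tree h1 xm) (meets_gap_tree h2 my) -!leqNgt.
have split_c : (x <= c < y) = (x <= c < m) || (m <= c < y).
  case: (ltnP c m) => cm /=; rewrite ?andbT ?andbF /=.
    by rewrite orbF (ltn_trans cm my) andbT.
  by rewrite (leq_trans (ltnW xm) cm).
rewrite split_c andb_orl.
case: (leqP (phi m) (phi x)) => c1.
  have e : phi m = phi x by apply/val_inj/eqP; rewrite /= eqn_leq c1 mono // ltnW.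
  by rewrite (no_jump _ _ c1) /=; apply: IH2; rewrite ?e.
case: (leqP (phi y) (phi m)) => c2.
  have e : phi m = phi y by apply/val_inj/eqP; rewrite /= eqn_leq c2 mono // ltnW.
  by rewrite (no_jump _ _ c2) orbF; apply: IH1; rewrite ?e.
have hm' : highest T (gap (phi x) (phi y)) = Some (phi m).
  apply: (natural (@gap_convex _ _) hm); last by rewrite inE c1.
  by move=> z; rewrite !inE => /andP[/phi_lt-> /phi_lt->].
case: t ht => [b [_]|t1 t2 [m' []]]; rewrite /= hm' // => -[<-] g1 g2.
by rewrite (IH1 _ _ _ h1 g1) // (IH2 _ _ _ h2 g2).
Qed.

(** A vertex with the same image as its predecessor uses up no target tree. Any other vertex goes to
    the next vertex of the target spine, again by [natural]. *)
Lemma chit_rchain x us ts (c d : point) : rchain x us -> rchain (phi x) ts ->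
  chit (map snd us) (map snd ts) jumps c d =
  (x <= c < n) && (phi c <= d < phi (cell_top c)).
Proof.
elim: us x ts => [|[m u] us IH] x ts /=.
  move=> /rchain_top -> _.
  by case: (ltnP c n); rewrite ?andbF.
case=> hm hu hus hts; have [] := highestP hm; rewrite inE => xm _.
have split_c : (x <= c < n) = (x <= c < m) || (m <= c < n).
  case: (ltnP c m) => cm /=; rewrite ?andbT ?andbF /=.
    by rewrite orbF (leq_trans cm (leq_ord m)) andbT.
  by rewrite (leq_trans (ltnW xm) cm).
rewrite (meets_gap_tree hu xm) split_c andb_orl; case: (ltnP (phi x) (phi m)) => lt; last first.
  have e : phi m = phi x by apply/val_inj/eqP; rewrite /= eqn_leq lt mono // ltnW.
  by rewrite (no_jump _ _ lt) (IH m) ?e.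
have hm' : highest T (above (phi x)) = Some (phi m).
  apply: (natural (@above_convex _) hm); last by rewrite inE.
  by move=> z; rewrite !inE => /phi_lt.
case: ts hts => [|[m' t] ts] /=; rewrite hm' // => -[[<-] ht hts].
by rewrite (hit_gap_tree _ _ hu ht) // (IH m).
Qed.

Lemma chit_lchain x us ts (c d : point) : lchain x us -> lchain (phi x) ts ->
  chit (map snd us) (map snd ts) jumps c d =
  (c < x) && (phi c <= d < phi (cell_top c)).
Proof.
elim: us x ts => [|[m u] us IH] x ts /=.
  by move=> /lchain_bot -> _; rewrite ltn0.
case=> hm hu hus hts; have [] := highestP hm; rewrite inE => mx _.
have split_c : (c < x) = (m <= c < x) || (c < m).
  by case: (ltnP c m) => cm /=; rewrite ?andbT ?andbF ?orbF /= ?(ltn_trans cm mx).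
rewrite (meets_gap_tree hu mx) split_c andb_orl; case: (ltnP (phi m) (phi x)) => lt; last first.
  have e : phi m = phi x by apply/val_inj/eqP; rewrite /= eqn_leq lt mono // ltnW.
  by rewrite (no_jump _ _ lt) (IH m) ?e.
have hm' : highest T (under (phi x)) = Some (phi m).
  apply: (natural (@under_convex _) hm); last by rewrite inE.
  by move=> z; rewrite !inE => /phi_lt.
case: ts hts => [|[m' t] ts] /=; rewrite hm' // => -[[<-] ht hts].
by rewrite (hit_gap_tree _ _ hu ht) // (IH m).
Qed.

Lemma phi_root r : rt T = Some r -> phi r = r.
Proof.
move=> hr; have [r' []] := root_ex; rewrite hr => -[<-] top.
have hs : highest T [set: point] = Some r.
  by apply: highestE => [|y _]; [apply: in_setT|apply: top].
have : highest T [set: point] = Some (phi r).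
  by apply: (natural _ hs) => [x y z|x|]; rewrite !in_setT.
by rewrite hs => -[].
Qed.

(** As [phi] fixes the root, each spine is mapped into itself. *)
Lemma whit_jumps r ls rs (c d : point) : rt T = Some r -> lchain r ls -> rchain r rs ->
  c < n ->
  whit (map snd ls) (map snd rs) jumps c d = (phi c <= d < phi (cell_top c)).
Proof.
move=> hr hl hrs cn; have e := phi_root hr.
rewrite /whit (@chit_lchain r _ _ _ _ hl) ?(@chit_rchain r _ _ _ _ hrs) ?e //.
by rewrite -andb_orl cn andbT; case: ltnP.
Qed.

End Map.
End OrderTree.

(** * Partition trees *)

Section PartitionTree.
Variables (n : nat) (T : tree 'I_n.+1).
Local Notation point := 'I_n.+1.
Hypothesis hT : order_preserving T.
Variables (K : {set {set point}}) (P : tree {set point}) (f : {set point} -> point).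
Hypotheses (hK : convex_partition K) (hP : is_partition_tree T K P) (hf : is_hom P T f).
Implicit Types (x y w : point) (B U V W Z : {set point}).

Let vP : verts P = K. Proof. by case: hP. Qed.

Lemma block_ex x : pblock K x \in K /\ x \in pblock K x.
Proof.
have [/and3P[/eqP cK _ _] _] := hK.
by rewrite pblock_mem ?mem_pblock cK.
Qed.

Lemma block_def B x : B \in K -> x \in B -> pblock K x = B.
Proof. by have [/and3P[_ tK _] _] := hK; apply: def_pblock. Qed.

Lemma block_eq B U x : B \in K -> U \in K -> x \in B -> x \in U -> B = U.
Proof. by move=> BK UK xB xU; rewrite -(block_def BK xB) (block_def UK xU). Qed.

Lemma block_inh B : B \in K -> exists x, x \in B.
Proof.
move=> BK; have [/and3P[_ _ n0] _] := hK; apply/set0Pn.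
by apply: contraNneq n0 => <-.
Qed.

Lemma block_convex B x y z : B \in K -> x \in B -> z \in B -> x <= y <= z -> y \in B.
Proof. by move=> BK; apply: (proj2 hK _ BK x y z). Qed.

Lemma coveredP V x :
  reflect (exists U, [/\ U \in K, desceq P U V & x \in U]) (x \in covered P V).
Proof.
apply: (iffP bigcupP) => [[U /andP[UK UV] xU]|[U [UK UV xU]]]; exists U => //.
  by split=> //; rewrite -vP.
by rewrite vP UK.
Qed.

Lemma covered_self V : V \in K -> V \subset covered P V.
Proof. by move=> VK; apply/subsetP=> x xV; apply/coveredP; exists V; rewrite desc_refl. Qed.

Lemma covered_mono V Z x : desceq P V Z -> x \in covered P V -> x \in covered P Z.
Proof.
move=> VZ /coveredP[U [UK UV xU]]; apply/coveredP; exists U; split=> //.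
exact: desc_trans VZ.
Qed.

Lemma gap_lP V x : reflect ((forall w, w \in V -> x < w) /\
    forall y, x <= y -> (forall w, w \in V -> y < w) -> y \notin covered P V)
  (x \in gap_l P V).
Proof.
rewrite inE; apply: (iffP andP) => -[/forall_inP h1 h2]; split=> //.
- move=> y xy yV; move/forallP: h2 => /(_ y); rewrite xy /= => /implyP; apply.
  exact/forall_inP.
- by apply/forallP=> y; apply/implyP=> /andP[xy /forall_inP yV]; apply: h2.
Qed.

Lemma gap_rP V x : reflect ((forall w, w \in V -> w < x) /\
    forall y, y <= x -> (forall w, w \in V -> w < y) -> y \notin covered P V)
  (x \in gap_r P V).
Proof.
rewrite inE; apply: (iffP andP) => -[/forall_inP h1 h2]; split=> //.
- move=> y xy yV; move/forallP: h2 => /(_ y); rewrite xy /= => /implyP; apply.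
  exact/forall_inP.
- by apply/forallP=> y; apply/implyP=> /andP[xy /forall_inP yV]; apply: h2.
Qed.

(** A gap of [Z] stops at every ancestor of [Z], in particular at [V] and at whatever bounds the gap
    of [V] on the other side. *)
Lemma gap_l_sub V Z x : V \in K -> Z \in K -> desceq P V Z -> Z \subset gap_l P V ->
  (x \in gap_l P Z) || (x \in gap_r P Z) -> x \in gap_l P V.
Proof.
move=> VK ZK VZ /subsetP Zs; have [z zZ] := block_inh ZK.
have /gap_lP[zV hz] := Zs _ zZ.
case/orP=> [/gap_lP[xZ hx]|/gap_rP[xZ hx]]; apply/gap_lP; split.
- by move=> w wV; apply: ltn_trans (xZ _ zZ) (zV _ wV).
- move=> y xy yV; have [/forall_inP yZ|] := boolP [forall w in Z, y < w].
    by apply/negP=> /(covered_mono VZ); apply/negP; apply: hx.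
  rewrite negb_forall => /existsP[w]; rewrite negb_imply -leqNgt => /andP[wZ wy].
  by have /gap_lP[_ hw] := Zs _ wZ; apply: hw.
- move=> w wV; rewrite ltnNge; apply/negP=> wx.
  have : w \notin covered P Z.
    by apply: hx => // w' w'Z; have /gap_lP[h _] := Zs _ w'Z; apply: h.
  by case/negP; apply: (covered_mono VZ); apply: (subsetP (covered_self VK)).
- by move=> y xy yV; apply: hz => //; apply: leq_trans (ltnW (xZ _ zZ)) xy.
Qed.

Lemma gap_r_sub V Z x : V \in K -> Z \in K -> desceq P V Z -> Z \subset gap_r P V ->
  (x \in gap_l P Z) || (x \in gap_r P Z) -> x \in gap_r P V.
Proof.
move=> VK ZK VZ /subsetP Zs; have [z zZ] := block_inh ZK.
have /gap_rP[zV hz] := Zs _ zZ.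
case/orP=> [/gap_lP[xZ hx]|/gap_rP[xZ hx]]; apply/gap_rP; split.
- move=> w wV; rewrite ltnNge; apply/negP=> wx.
  have : w \notin covered P Z.
    by apply: hx => // w' w'Z; have /gap_rP[h _] := Zs _ w'Z; apply: h.
  by case/negP; apply: (covered_mono VZ); apply: (subsetP (covered_self VK)).
- by move=> y xy yV; apply: hz => //; apply: leq_trans xy (ltnW (xZ _ zZ)).
- by move=> w wV; apply: ltn_trans (zV _ wV) (xZ _ zZ).
- move=> y xy yV; have [/forall_inP yZ|] := boolP [forall w in Z, w < y].
    by apply/negP=> /(covered_mono VZ); apply/negP; apply: hx.
  rewrite negb_forall => /existsP[w]; rewrite negb_imply -leqNgt => /andP[wZ wy].
  by have /gap_rP[_ hw] := Zs _ wZ; apply: hw.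
Qed.

(** A gap is bounded by whole blocks, so it is a union of blocks. *)
Lemma gap_l_sat V x : V \in K -> x \in gap_l P V -> pblock K x \subset gap_l P V.
Proof.
move=> VK /gap_lP[xV hx]; have [BK xB] := block_ex x.
have xc : x \notin covered P V by apply: hx.
apply/subsetP=> x' x'B; apply/gap_lP; split=> [w wV|y x'y yV].
  rewrite ltnNge; apply/negP=> wx'.
  have wB : w \in pblock K x by apply: (block_convex BK xB x'B); rewrite wx' ltnW ?xV.
  by have := xV x; rewrite -(block_eq BK VK wB wV) ltnn => /(_ xB).
have [xy|yx] := leqP x y; first exact: hx.
have yB : y \in pblock K x by apply: (block_convex BK x'B xB); rewrite x'y ltnW.
apply: contra xc => /coveredP[U [UK UV yU]]; apply/coveredP; exists U; split=> //.
by rewrite -(block_eq BK UK yB yU).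
Qed.

Lemma gap_r_sat V x : V \in K -> x \in gap_r P V -> pblock K x \subset gap_r P V.
Proof.
move=> VK /gap_rP[xV hx]; have [BK xB] := block_ex x.
have xc : x \notin covered P V by apply: hx.
apply/subsetP=> x' x'B; apply/gap_rP; split=> [w wV|y x'y yV].
  rewrite ltnNge; apply/negP=> wx'.
  have wB : w \in pblock K x by apply: (block_convex BK x'B xB); rewrite wx' ltnW ?xV.
  by have := xV x; rewrite -(block_eq BK VK wB wV) ltnn => /(_ xB).
have [xy|yx] := leqP y x; first exact: hx.
have yB : y \in pblock K x by apply: (block_convex BK xB x'B); rewrite x'y ltnW.
apply: contra xc => /coveredP[U [UK UV yU]]; apply/coveredP; exists U; split=> //.
by rewrite -(block_eq BK UK yB yU).
Qed.

Lemma child_gap Z Z' : Z \in K -> child P Z Z' ->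
  exists m, [/\ Z' = pblock K m, (m \in gap_l P Z) || (m \in gap_r P Z)
    & highest T (gap_l P Z) = Some m /\ son P Z = Some Z' \/
      highest T (gap_r P Z) = Some m /\ dau P Z = Some Z'].
Proof.
move=> ZK; case: hP => _ _ _ hs hd /child_cases[] h.
  have := hs _ ZK; rewrite h; case E: (highest _ _) => [m|] //= [->].
  exists m; split=> //; last by left.
  by have [->] := highestP E.
have := hd _ ZK; rewrite h; case E: (highest _ _) => [m|] //= [->].
exists m; split=> //; last by right.
by have [->] := highestP E; rewrite orbT.
Qed.

Lemma child_block Z Z' : Z \in K -> child P Z Z' -> Z' \in K.
Proof. by move=> ZK /(child_gap ZK)[m [-> _ _]]; have [] := block_ex m. Qed.

Lemma desc_ind (V : finType) (D : tree V) (Q : V -> Prop) (x y : V) :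
  desceq D x y -> Q x -> (forall z z', desceq D x z -> Q z -> child D z z' -> Q z') -> Q y.
Proof.
case/connectP=> p hp -> Qx step; elim/last_ind: p hp => [|p z IH] //=.
rewrite rcons_path last_rcons => /andP[hp ch].
by apply: step (IH hp) ch; apply/connectP; exists p.
Qed.

(* The set [G] is the gap in which [U] was selected.                          *)
Lemma block_top U : U \in K -> exists m (G : {set point}),
  [/\ m \in U, highest T G = Some m & forall Z, desceq P U Z -> Z \subset G].
Proof.
move=> UK; have [r [hr top]] := root_ex hT.
have rP : rt P = Some (pblock K r) by case: hP => _ _ ->; rewrite hr.
have := UK; rewrite -{1}vP /verts rP inE.
have Dblock Z Z' : desceq P Z Z' -> Z \in K -> Z' \in K.
  by move=> d ZK; apply: (@desc_ind _ P (fun z => z \in K) _ _ d) => // z z' _; apply: child_block.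
move=> d; apply: (@desc_ind _ P (fun V => exists m (G : {set point}),
  [/\ m \in V, highest T G = Some m & forall Z, desceq P V Z -> Z \subset G]) _ _ d).
  exists r, setT; split; first by have [] := block_ex r.
    by apply: highestE => //; rewrite inE.
  by move=> Z _; apply: subsetT.
move=> V Z dV _ ch; have VK := Dblock _ _ dV (proj1 (block_ex r)).
have ZK := child_block VK ch.
have [m [ZE mg side]] := child_gap VK ch.
case: side => -[hm _]; have [mG _] := highestP hm.
  exists m, (gap_l P V); split=> // [|Y ZY]; first by rewrite ZE; have [] := block_ex m.
  apply: (@desc_ind _ P (fun Y => Y \subset gap_l P V) _ _ ZY); first by rewrite ZE; apply: gap_l_sat.
  move=> Y1 Y2 ZY1 Ys ch'; have Y1K := Dblock _ _ ZY1 ZK.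
  have [m' [-> m'g _]] := child_gap Y1K ch'; apply: gap_l_sat => //.
  by apply: (gap_l_sub VK Y1K _ Ys m'g); apply: desc_trans (desc1 ch) ZY1.
exists m, (gap_r P V); split=> // [|Y ZY]; first by rewrite ZE; have [] := block_ex m.
apply: (@desc_ind _ P (fun Y => Y \subset gap_r P V) _ _ ZY); first by rewrite ZE; apply: gap_r_sat.
move=> Y1 Y2 ZY1 Ys ch'; have Y1K := Dblock _ _ ZY1 ZK.
have [m' [-> m'g _]] := child_gap Y1K ch'; apply: gap_r_sat => //.
by apply: (gap_r_sub VK Y1K _ Ys m'g); apply: desc_trans (desc1 ch) ZY1.
Qed.

Lemma parent_uniq p q x : child T p x -> child T q x -> p = q.
Proof. by case: hT => -[_ h _] vT _ _; apply: h; rewrite vT. Qed.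

Lemma hom_child V W : V \in K -> child P V W -> child T (f V) (f W).
Proof.
rewrite -vP => VK; case: hf => _ hs hd /child_cases[] h.
  by apply: son_child; apply: hs.
by apply: dau_child; apply: hd.
Qed.

(** Parents in [T] are unique, and [f] preserves the root and the parent relation, so the image of
    [P] is closed under ancestors. *)
Lemma hom_ancestor W u : W \in K -> desceq T u (f W) ->
  exists U, [/\ U \in K, desceq P U W & f U = u].
Proof.
move=> WK; have [r [hr top]] := root_ex hT.
have rP : rt P = Some (pblock K r) by case: hP => _ _ ->; rewrite hr.
have rf : f (pblock K r) = r.
  by case: hf => -[_ _ /(_ _ rP)]; rewrite hr => -[].
have := WK; rewrite -{1}vP /verts rP inE => d.
suff: desceq T u (f W) -> exists U, [/\ U \in K, desceq P U W & f U = u] by [].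
apply: (@desc_ind _ P (fun W => desceq T u (f W) ->
  exists U, [/\ U \in K, desceq P U W & f U = u]) _ _ d) => [ur|V Z dV IH ch uZ].
  exists (pblock K r); rewrite desc_refl; split=> //; first by have [] := block_ex r.
  by rewrite rf in ur *; apply: (desc_anti hT).
have VK : V \in K.
  by apply: (@desc_ind _ P (fun z => z \in K) _ _ dV) => [|z z' _]; [have [] := block_ex r|apply: child_block].
have [uE|[q chq uq]] : u = f Z \/ exists2 q, child T q (f Z) & desceq T u q.
  case/connectP: uZ => p; case/lastP: p => [|p z]; first by move=> _ ->; left.
  rewrite rcons_path last_rcons => /andP[hp hz] zE; right.
  by exists (last u p); rewrite ?zE //; apply/connectP; exists p.
  by exists Z; rewrite desc_refl; split=> //; apply: child_block ch.
rewrite (parent_uniq chq (hom_child VK ch)) in uq.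
have [U [UK UV fU]] := IH uq; exists U; split=> //.
exact: desc_trans UV (desc1 ch).
Qed.

(* The highest point of [G'] is an ancestor of the image of [m], hence the    *)
(* image of an ancestor of the block of [m]; the highest point of the gap in  *)
(* which this ancestor was selected can only be [m].                          *)
Lemma hom_natural (G G' : {set point}) m : convex G' -> highest T G = Some m ->
  (forall x, f (pblock K x) \in G' -> x \in G) -> f (pblock K m) \in G' ->
  highest T G' = Some (f (pblock K m)).
Proof.
move=> cG' hm pre mG'; have [WK mW] := block_ex m.
have [u hu] := highest_ex hT mG' cG'.
have [uG' utop] := highestP hu; have [mG mtop] := highestP hm.
have [U [UK UW fU]] := hom_ancestor WK (utop _ mG').
have [mU [H [mUU hmU sub]]] := block_top UK.
have [_ tH] := highestP hmU.
rewrite hu; congr Some; rewrite -fU; congr f.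
suff -> : m = mU by rewrite (block_def UK mUU).
apply: (desc_anti hT).
  by apply/mtop/pre; rewrite (block_def UK mUU) fU.
by apply/tH/(subsetP (sub _ UW)).
Qed.

End PartitionTree.

Lemma Phi_natural (n : nat) (T : tree 'I_n.+1) phi : order_preserving T -> Phi T phi ->
  forall (G G' : {set 'I_n.+1}) m, convex G' -> highest T G = Some m ->
  (forall x, phi x \in G' -> x \in G) -> phi m \in G' -> highest T G' = Some (phi m).
Proof.
move=> hT [K [P [f [hK hP hf e]]]] G G' m cG' hm pre; rewrite e => mG'.
by apply: (hom_natural hT hK hP hf cG' hm) => // x; rewrite -e; apply: pre.
Qed.

(** * Isomorphisms and bijections of cells *)

Section Model.
Variables (X L : finType) (D : {set L}).
Implicit Types (R : {set {ffun X -> X}}) (w : {set L} -> L -> L -> bool).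

(* Up to [j], [R] is the set of subsets of [D], with [S * S'] the set of the  *)
(* points of [S] that are related by [w S] to a point of [S'].                *)
Record model R (j : {ffun X -> X} -> {set L}) w : Prop := Model {
  mod_mul : {in R &, forall p q, tmul p q \in R};
  mod_sub : forall p, p \in R -> j p \subset D;
  mod_inj : {in R &, injective j};
  mod_onto : forall S : {set L}, S \subset D -> exists2 p, p \in R & j p = S;
  mod_tmul : {in R &, forall p q,
    j (tmul p q) = [set c in j p | [exists d in j q, w (j p) c d]]};
  mod_hit : forall (S : {set L}) c, S \subset D -> c \in S -> exists d, w S c d;
  mod_in : forall (S : {set L}) c d, S \subset D -> c \in S -> w S c d -> d \in D;
  mod_fun : forall (S : {set L}) c c' d, S \subset D -> c \in S -> c' \in S ->
    w S c d -> w S c' d -> c = c' }.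

Section One.
Variables (R : {set {ffun X -> X}}) (j : {ffun X -> X} -> {set L})
  (w : {set L} -> L -> L -> bool).
Hypothesis h : model R j w.

(* Right divisibility is inclusion, so that an isomorphism of semigroups is   *)
(* an isomorphism of Boolean lattices, determined by its action on the atoms. *)
Lemma mod_le p q : p \in R -> q \in R ->
  (j p \subset j q) <-> exists2 r, r \in R & p = tmul q r.
Proof.
move=> pR qR; split=> [pq|[r rR ->]]; last first.
  by rewrite (mod_tmul h) //; apply/subsetP=> c; rewrite inE => /andP[].
have qD := mod_sub h qR.
(* The right factor gets all points related to a point of [j p]. By [mod_fun] no other point of
   [j q] is related to any of them. *)
pose S := [set d | [exists c in j p, w (j q) c d]].
have SD : S \subset D.
  apply/subsetP=> d; rewrite inE => /existsP[c /andP[cp cd]].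
  by apply: (mod_in h qD _ cd); apply: (subsetP pq).
have [r rR rS] := mod_onto h SD; exists r => //.
apply: (mod_inj h) => //; first exact: (mod_mul h).
rewrite (mod_tmul h) // rS; apply/setP=> c; rewrite inE; apply/idP/andP=> [cp|[cq]].
  have cq := subsetP pq _ cp; split=> //.
  have [d cd] := mod_hit h qD cq; apply/existsP; exists d; rewrite cd andbT inE.
  by apply/existsP; exists c; rewrite cp.
case/existsP=> d /andP[]; rewrite inE => /existsP[c' /andP[c'p c'd]] cd.
by rewrite (mod_fun h qD cq (subsetP pq _ c'p) cd c'd).
Qed.

End One.

Variables (R R' : {set {ffun X -> X}}) (j j' : {ffun X -> X} -> {set L})
  (w w' : {set L} -> L -> L -> bool).
Hypotheses (h : model R j w) (h' : model R' j' w').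

Definition transports (f : L -> L) := [/\ injective f,
  forall x, (f x \in D) = (x \in D)
  & forall (S : {set L}) c d, S \subset D -> c \in S -> w S c d = w' (f @: S) (f c) (f d)].

Lemma transports_iso f : transports f -> semigroup_isomorphic R R'.
Proof.
move=> [fI fD fw].
have imD (S : {set L}) : S \subset D -> f @: S \subset D.
  by move=> /subsetP SD; apply/subsetP=> _ /imsetP[x /SD xD ->]; rewrite fD.
(* For [p] in [R] the search succeeds by [mod_onto], so the default is not reached. *)
pose F p := odflt p [pick q in R' | j' q == f @: j p].
have FP p : p \in R -> F p \in R' /\ j' (F p) = f @: j p.
  move=> pR; rewrite /F; case: pickP => [q /andP[qR /eqP]|none] //.
  have [q qR qE] := mod_onto h' (imD _ (mod_sub h pR)).
  by have := none q; rewrite qR qE eqxx.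
have fI2 := imset_inj fI.
exists F; split.
- move=> p q pR qR e; apply: (mod_inj h) => //; apply: fI2.
  by have [_ <-] := FP _ pR; have [_ <-] := FP _ qR; rewrite e.
- apply/setP=> q; apply/imsetP/idP=> [[p pR ->]|qR]; first by have [] := FP _ pR.
  have [|p pR pE] := @mod_onto _ _ _ h (f @^-1: j' q).
    by apply/subsetP=> x; rewrite inE => /(subsetP (mod_sub h' qR)); rewrite fD.
  exists p => //; have [FR Fj] := FP _ pR.
  apply: (mod_inj h') => //; rewrite Fj pE; apply/setP=> y.
  have [g _ gK] := injF_bij fI.
  by rewrite -[y]gK mem_imset // inE.
move=> p q pR qR; have pqR := mod_mul h pR qR.
have [[[FpR Fp] [FqR Fq]] [FpqR Fpq]] := (FP _ pR, FP _ qR, FP _ pqR).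
apply: (mod_inj h') => //; first exact: (mod_mul h').
rewrite Fpq (mod_tmul h) // (mod_tmul h') //; apply/setP=> y.
have [g _ gK] := injF_bij fI; rewrite -[y]gK; move: (g y) => c {y}.
rewrite mem_imset // !inE Fp mem_imset //; case cp: (c \in j p) => //=.
apply/existsP/existsP=> -[d /andP[dq cd]].
  exists (f d); rewrite Fq mem_imset // dq -fw //; exact: (mod_sub h).
exists (g d); rewrite fw ?gK //; last exact: (mod_sub h).
by rewrite -(mem_imset _ _ fI) gK -Fq dq.
Qed.

(** By [mod_le] an isomorphism preserves inclusion, hence the empty set and the singletons, which
    defines [f]. The relation [w] is then recovered from products with singletons. *)
Lemma iso_transports : semigroup_isomorphic R R' -> exists f, transports f.
Proof.
move=> [F [FI FR FM]].
have FR' p : p \in R -> F p \in R' by move=> pR; rewrite -FR imset_f.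
have FS q : q \in R' -> exists2 p, p \in R & q = F p.
  by rewrite -FR => /imsetP[p pR ->]; exists p.
have Fle p q : p \in R -> q \in R -> (j' (F p) \subset j' (F q)) = (j p \subset j q).
  move=> pR qR; apply/idP/idP=> [/(mod_le h' (FR' _ pR) (FR' _ qR))|/(mod_le h pR qR)].
    case=> r' /FS[r rR ->]; rewrite -FM // => e; apply/(mod_le h pR qR).
    by exists r => //; apply: FI => //; apply: (mod_mul h).
  case=> r rR e; apply/(mod_le h' (FR' _ pR) (FR' _ qR)).
  by exists (F r); rewrite ?FR' // e FM.
have [z zR zE] := mod_onto h (sub0set D).
have [z' zR' zE'] := mod_onto h' (sub0set D).
have Fz : j' (F z) = set0.
  have [p pR e] := FS _ zR'.
  by apply/eqP; rewrite -subset0 -zE' e Fle // zE sub0set.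
have single c : c \in D -> exists2 p, p \in R & j p = [set c].
  by move=> cD; apply: (mod_onto h); rewrite sub1set.
have F1 c p : c \in D -> p \in R -> j p = [set c] -> exists c', j' (F p) = [set c'].
  move=> cD pR pE; have [e|[c' c'F]] := set_0Vmem (j' (F p)).
    have := Fle p z pR zR; rewrite e sub0set zE pE sub1set inE.
    by [].
  have c'D : c' \in D by apply: (subsetP (mod_sub h' (FR' _ pR))).
  have [|q' qR' qE'] := @mod_onto _ _ _ h' [set c']; first by rewrite sub1set.
  have [q qR qq] := FS _ qR'; exists c'; rewrite -qE' qq.
  have qp : j q \subset j p by rewrite -Fle // -qq qE' sub1set.
  congr (j' (F _)); apply: (mod_inj h) => //; apply/eqP.
  rewrite eqEsubset qp andbT pE sub1set.
  have [q0|[y yq]] := set_0Vmem (j q).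
    have := Fle q z qR zR; rewrite q0 sub0set -qq qE' Fz sub1set inE.
    by [].
  by have := subsetP qp _ yq; rewrite pE inE => /eqP<-.
(* The identity outside [D] keeps [f] injective on the whole type. *)
pose f c := if c \in D then odflt c [pick c' | [exists p in R, (j p == [set c]) && (j' (F p) == [set c'])]] else c.
have fP c : c \in D -> exists p, [/\ p \in R, j p = [set c] & j' (F p) = [set f c]].
  move=> cD; rewrite /f cD; case: pickP => [c' /existsP[p /and3P[pR /eqP pE /eqP FE]]|none].
    by exists p.
  have [p pR pE] := single c cD; have [c' c'E] := F1 c p cD pR pE.
  by have /existsP[] := none c'; exists p; rewrite pR pE c'E !eqxx.
have fD c : (f c \in D) = (c \in D).
  case: (boolP (c \in D)) => [cD|cD]; last by rewrite /f (negPf cD) (negPf cD).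
  have [p [pR pE FE]] := fP c cD.
  by apply: (subsetP (mod_sub h' (FR' _ pR))); rewrite FE set11.
have fI : injective f.
  move=> c c' e; case: (boolP (c \in D)) => cD; last first.
    have c'D : c' \notin D by rewrite -fD -e fD.
    by move: e; rewrite /f (negPf cD) (negPf c'D).
  have c'D : c' \in D by rewrite -fD -e fD.
  have [[p [pR pE FE]] [p' [pR' pE' FE']]] := (fP c cD, fP c' c'D).
  apply: set1_inj; rewrite -pE -pE'; congr j; apply: FI => //.
  by apply: (mod_inj h'); rewrite ?FR' // FE FE' e.
have fj p c : p \in R -> (f c \in j' (F p)) = (c \in j p).
  move=> pR; case: (boolP (c \in D)) => cD; last first.
    have [/negPf-> /negPf->//] : f c \notin j' (F p) /\ c \notin j p.
    split; [rewrite -fD in cD|]; apply: contra cD; apply: subsetP.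
      exact: (mod_sub h' (FR' _ pR)).
    exact: mod_sub h _ pR.
  have [q [qR qE FE]] := fP c cD.
  by rewrite -sub1set -FE Fle // qE sub1set.
have [g _ gK] := injF_bij fI.
have Fj p : p \in R -> j' (F p) = f @: j p.
  by move=> pR; apply/setP=> y; rewrite -[y]gK fj // mem_imset.
exists f; split=> // S c d SD cS.
have [p pR pE] := mod_onto h SD.
case: (boolP (d \in D)) => dD; last first.
  transitivity false; first by apply: contraNF dD => /(mod_in h SD cS).
  apply/esym; apply: contraNF dD; rewrite -fD; apply: (mod_in h' _ _).
    by rewrite -pE -Fj //; apply: (mod_sub h' (FR' _ pR)).
  by rewrite mem_imset.
(* With the singleton of [d] as right factor, [c] remains in the product iff [w S c d]. *)
have [q qR qE] := single d dD.
have := fj _ c (mod_mul h pR qR).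
rewrite FM // (mod_tmul h) // (mod_tmul h') ?FR' // !inE fj // pE cS /=.
have ex1 (Q : pred L) a : [exists x in [set a], Q x] = Q a.
  apply/existsP/idP=> [[x /andP[]]|Qa]; first by rewrite inE => /eqP->.
  by exists a; rewrite set11.
by rewrite !Fj // pE qE imset_set1 !ex1.
Qed.

End Model.

(** * A cross-section as a model on the set of cells *)

Section CrossSection.
Variables (n : nat) (T : tree 'I_n.+1) (R : {set {ffun 'I_n.+1 -> 'I_n.+1}}).
Local Notation point := 'I_n.+1.
Hypotheses (hT : order_preserving T) (hR : R_cross_section R)
  (hRT : forall phi, phi \in R <-> Phi T phi).

Definition cells : {set point} := [set c : point | c < n].

Lemma mono_in (phi : {ffun point -> point}) : phi \in R ->
  forall x y : point, x <= y -> phi x <= phi y.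
Proof.
case: hR => /subsetP h _ _ /h; rewrite inE => /forallP h1 x y.
by move/forallP: (h1 x) => /(_ y)/implyP.
Qed.

Lemma kernel_jumps (phi : point -> point) :
  (forall x y : point, x <= y -> phi x <= phi y) -> forall x y : point, x <= y ->
  phi x = phi y <-> forall c : point, x <= c < y -> c \notin jumps phi.
Proof.
move=> mono x y xy; split=> [e c cxy|none].
  rewrite inE; apply/negP=> /andP[_ lt]; have [h1 h2 _] := cell_in mono cxy.
  by have := leq_ltn_trans h1 (leq_trans lt h2); rewrite e ltnn.
apply: val_inj; apply/eqP; rewrite /= eqn_leq mono //= leqNgt; apply/negP=> lt.
by have [c cxy] := jump_ex mono lt; apply/negP; apply: none.
Qed.

Lemma kernel_eq (phi psi : point -> point) :
  (forall x y : point, x <= y -> phi x <= phi y) ->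
  (forall x y : point, x <= y -> psi x <= psi y) ->
  jumps phi = jumps psi <-> forall x y, phi x = phi y <-> psi x = psi y.
Proof.
move=> m1 m2; split=> [e x y|e].
  wlog xy : x y / x <= y.
    move=> W; case/orP: (leq_total x y) => [/W//|/W h].
    by split=> /esym/h/esym.
  split=> [/(kernel_jumps m1 xy)|/(kernel_jumps m2 xy)] none.
    by apply/(kernel_jumps m2 xy); rewrite -e.
  by apply/(kernel_jumps m1 xy); rewrite e.
have jE (p : point -> point) : (forall x y : point, x <= y -> p x <= p y) ->
    forall c, (c \in jumps p) = (c < n) && (p c != p (cell_top c)).
  move=> m c; rewrite inE; case: (ltnP c n) => //= cn.
  by rewrite ltn_neqAle m ?andbT // cell_topE.
by apply/setP=> c; rewrite !jE //; congr (_ && ~~ _); apply/eqP/eqP=> /e.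
Qed.

Lemma jumps_inj : {in R &, injective (fun p : {ffun point -> point} => jumps p)}.
Proof.
move=> p q pR qR /(kernel_eq (mono_in pR) (mono_in qR)) e.
case: hR => /subsetP sub _ ex; have [b [_ bu]] := ex p (sub _ pR).
by rewrite -(bu p) ?(bu q).
Qed.

(** Counting the cells of [S] to the left of a point gives an order-preserving map that jumps
    exactly at [S]. The member of [R] with the same kernel has the same jumps. *)
Lemma jumps_onto (S : {set point}) : S \subset cells ->
  exists2 p : {ffun point -> point}, p \in R & jumps p = S.
Proof.
move=> /subsetP Sn.
pose N (x : point) := #|[set c in S | c < x]|.
have mN (x y : point) : x <= y -> N x <= N y.
  move=> xy; apply: subset_leq_card; apply/subsetP=> c; rewrite !inE => /andP[-> cx].
  exact: leq_trans cx xy.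
have Nn x : N x < n.+1.
  rewrite ltnS; apply: (@leq_trans #|cells|).
    by apply: subset_leq_card; apply/subsetP=> c; rewrite inE => /andP[/Sn].
  have -> : cells = ~: [set ord_max].
    apply/setP=> c; rewrite !inE -val_eqE /= ltn_neqAle -ltnS ltn_ord andbT.
    by [].
  by rewrite cardsC1 card_ord.
pose a : {ffun point -> point} := [ffun x => Ordinal (Nn x)].
have ma (x y : point) : x <= y -> a x <= a y by move=> xy; rewrite !ffunE /= mN.
have aT : a \in op_transf n.
  by rewrite inE; apply/forallP=> x; apply/forallP=> y; apply/implyP; apply: ma.
case: hR => _ _ /(_ a aT)[p [[pR pa] _]]; exists p => //.
transitivity (jumps a).
  by apply/(kernel_eq (mono_in pR) ma) => x y; split=> /pa.
apply/setP=> c; rewrite inE !ffunE /=; case: (ltnP c n) => [cn|nc] /=; last first.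
  by apply/esym/negbTE; apply: contraL nc => /Sn; rewrite inE -ltnNge.
have NS : [set c' in S | c' < cell_top c] = (if c \in S then c |: [set c' in S | c' < c] else [set c' in S | c' < c]).
  apply/setP=> x; rewrite (fun_if (fun A : {set _} => x \in A)) !inE cell_topE // ltnS leq_eqVlt.
  have -> : (x == c :> nat) = (x == c) by [].
  by case: eqP => [->|] /=; rewrite ?ltnn ?andbT ?andbF; case: (c \in S).
rewrite /N NS; case: (c \in S); last by rewrite ltnn.
by rewrite cardsU1 !inE ltnn andbF add1n ltnS leqnn.
Qed.

(** By [whit_jumps], [whit] relates [c] to the cells between the images of its ends. The product
    jumps at [c] iff the second factor jumps inside this interval, and distinct cells have disjoint
    intervals. *)
Lemma cross_model r ls rs : rt T = Some r -> lchain T r ls -> rchain T r rs ->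
  model cells R (fun p => jumps p) (whit (map snd ls) (map snd rs)).
Proof.
move=> hr hl hrs.
have W p (c d : point) : p \in R -> c < n ->
    whit (map snd ls) (map snd rs) (jumps p) c d = (p c <= d < p (cell_top c)).
  move=> pR cn; apply: (whit_jumps hT (mono_in pR) _ _ hr hl hrs cn).
  by apply: Phi_natural => //; apply/hRT.
split.
- by case: hR.
- by move=> p _; apply/subsetP=> c; rewrite !inE => /andP[].
- exact: jumps_inj.
- exact: jumps_onto.
- move=> p q pR qR; apply/setP=> c; rewrite !inE !ffunE.
  case: (ltnP c n) => //= cn.
  have -> : [exists d in jumps q, whit (map snd ls) (map snd rs) (jumps p) c d] =
            [exists d : point, (d \in jumps q) && (p c <= d < p (cell_top c))].
    by apply: eq_existsb => d; rewrite W.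
  apply/idP/andP=> [lt|[lt /existsP[d /andP[dq dp]]]].
    have [d dd dq] := jump_ex (mono_in qR) lt.
    split; first by case/andP: dd => /leq_ltn_trans h /h.
    by apply/existsP; exists d; rewrite dq.
  have [h1 h2 _] := cell_in (mono_in qR) dp.
  apply: leq_ltn_trans h1 (leq_trans _ h2); move: dq; rewrite inE; by case/andP.
(* The image interval of a jump contains at least its lowest cell, [p c]. *)
- move=> S c SD cS; have [p pR pE] := jumps_onto SD; exists (p c).
  have := cS; rewrite -pE inE => /andP[cn lt].
  by rewrite W // leqnn.
- move=> S c d SD cS; have [p pR pE] := jumps_onto SD.
  have := cS; rewrite -pE inE => /andP[cn lt]; rewrite W // => /andP[_ dd].
  by rewrite inE (leq_trans dd) // -ltnS ltn_ord.
move=> S c c' d SD cS c'S; have [p pR pE] := jumps_onto SD.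
have := cS; have := c'S; rewrite -pE !inE => /andP[c'n _] /andP[cn _].
rewrite !W // => /andP[h1 h2] /andP[h3 h4].
have aux (a b : point) : a < n -> p b <= d -> d < p (cell_top a) -> b <= a.
  move=> an pb pa; rewrite leqNgt; apply/negP=> ab.
  have : p (cell_top a) <= p b by apply: mono_in; rewrite ?cell_topE.
  by rewrite leqNgt (leq_ltn_trans pb pa).
by apply: val_inj; apply/eqP; rewrite /= eqn_leq; apply/andP; split; apply: aux.
Qed.

End CrossSection.

(** * Isomorphisms of rooted trees *)

(** Inductive trees allow recursion, which the records [tree], given by partial functions, do not.
    [rep] links the two, and [Ge] is the empty tree. *)
Inductive gtree (V : Type) := Ge | Gn of V & gtree V & gtree V.
Arguments Ge {V}.

Fixpoint nodes (V : Type) (g : gtree V) : seq V :=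
  if g is Gn v a b then v :: nodes a ++ nodes b else [::].

Fixpoint gmap (V W : Type) (f : V -> W) (g : gtree V) : gtree W :=
  if g is Gn v a b then Gn (f v) (gmap f a) (gmap f b) else Ge.

Fixpoint gmirror (V : Type) (g : gtree V) : gtree V :=
  if g is Gn v a b then Gn v (gmirror b) (gmirror a) else Ge.

Definition gshape (V : Type) : gtree V -> gtree unit := gmap (fun=> tt).

Lemma nodes_gmap (V W : Type) (f : V -> W) g : nodes (gmap f g) = map f (nodes g).
Proof. by elim: g => //= v a -> b ->; rewrite map_cat. Qed.

Lemma gshape_gmap (V W : Type) (f : V -> W) g : gshape (gmap f g) = gshape g.
Proof. by rewrite /gshape; elim: g => //= v a -> b ->. Qed.

Lemma gmap_mirror (V W : Type) (f : V -> W) g : gmap f (gmirror g) = gmirror (gmap f g).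
Proof. by elim: g => //= v a -> b ->. Qed.

Lemma nodes_mirror (V : eqType) (g : gtree V) : perm_eq (nodes (gmirror g)) (nodes g).
Proof.
elim: g => //= v a pa b pb; rewrite perm_cons perm_catC.
exact: perm_cat.
Qed.

Lemma gsize_shape (V W : Type) (g : gtree V) (g' : gtree W) :
  gshape g = gshape g' -> size (nodes g) = size (nodes g').
Proof.
move=> e; have := congr1 (fun t => size (nodes t)) e.
by rewrite /= /gshape !nodes_gmap !size_map.
Qed.

Lemma gmap_of_shape (V W : eqType) (f : V -> W) g g' : gshape g = gshape g' ->
  map f (nodes g) = nodes g' -> gmap f g = g'.
Proof.
elim: g g' => [|v a IHa b IHb] [|w c d] //= [sa sb] [-> ].
rewrite map_cat => /eqP; rewrite eqseq_cat ?size_map ?(gsize_shape sa) //.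
by case/andP=> /eqP/(IHa _ sa)-> /eqP/(IHb _ sb)->.
Qed.

Lemma map_nth_index (V W : eqType) (w0 : W) (s : seq V) (t : seq W) : uniq s ->
  size s = size t -> map (fun x => nth w0 t (index x s)) s = t.
Proof.
case: s => [|x0 s] us st; first by case: t st.
apply: (@eq_from_nth _ w0) => [|i]; rewrite size_map // => ik.
by rewrite (nth_map x0) // index_uniq.
Qed.

Section Rep.
Variable V : finType.
Implicit Types (U : tree V) (g : gtree V).

Fixpoint rep U (o : option V) g : Prop :=
  if g is Gn v a b then [/\ o = Some v, rep U (son U v) a & rep U (dau U v) b]
  else o = None.

Lemma rep_nodes U o g x : rep U o g ->
  x \in nodes g <-> exists2 v, o = Some v & desceq U v x.
Proof.
elim: g o => [|v a IHa b IHb] o /=; first by move=> ->; split=> // -[].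
case=> -> ra rb; rewrite inE mem_cat; split.
  case/or3P=> [/eqP->|/(IHa _ ra)[w h1 h2]|/(IHb _ rb)[w h1 h2]]; exists v => //.
  - exact: desc_refl.
  - exact: desc_trans (desc1 (son_child h1)) h2.
  - exact: desc_trans (desc1 (dau_child h1)) h2.
case=> _ [<-] /desc_child[->|[c /child_cases[h1|h1] h2]]; first by rewrite eqxx.
  by apply/or3P/Or32/(IHa _ ra); exists c.
by apply/or3P/Or33/(IHb _ rb); exists c.
Qed.

Lemma rep_verts U g : rep U (rt U) g -> verts U =i nodes g.
Proof.
move=> r x; have [h1 h2] := rep_nodes x r; apply/idP/idP; rewrite /verts.
  by case E: (rt U) => [v|]; rewrite ?inE // => vx; apply: h2; exists v.
by case/h1=> v -> vx; rewrite inE.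
Qed.

Lemma rep_card U g : rep U (rt U) g -> uniq (nodes g) -> #|verts U| = size (nodes g).
Proof. by move=> r un; rewrite (eq_card (rep_verts r)); apply/card_uniqP. Qed.

Definition swap U : tree V := Tree (rt U) (dau U) (son U).

Lemma rep_swap U o g : rep U o g -> rep (swap U) o (gmirror g).
Proof. by elim: g o => //= v a IHa b IHb o [-> /IHa ? /IHb ?]. Qed.

Lemma verts_swap U : verts (swap U) = verts U.
Proof.
rewrite /verts /=; case: (rt U) => // r; apply/setP=> x; rewrite !inE /desceq.
by apply: eq_connect => p v; rewrite /child /= orbC.
Qed.

End Rep.

Fixpoint pre (V : eqType) (g g' : gtree V) : bool :=
  match g, g' with
  | Ge, _ => true
  | Gn v a b, Gn w c d => [&& v == w, pre a c & pre b d]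
  | _, _ => false
  end.

Lemma pre_size (V : eqType) (g g' : gtree V) : pre g g' -> size (nodes g) <= size (nodes g').
Proof.
elim: g g' => // v a IHa b IHb [|w c d] //= /and3P[_ /IHa h1 /IHb h2].
by rewrite ltnS !size_cat leq_add.
Qed.

Lemma pre_eq (V : eqType) (g g' : gtree V) : pre g g' ->
  size (nodes g') <= size (nodes g) -> g = g'.
Proof.
elim: g g' => [|v a IHa b IHb] [|w c d] //= /and3P[/eqP-> p1 p2].
have [s1 s2] := (pre_size p1, pre_size p2); rewrite ltnS !size_cat => le.
have ca : size (nodes c) <= size (nodes a).
  rewrite -(leq_add2r (size (nodes d))); apply: leq_trans le _.
  by rewrite leq_add2l.
have db : size (nodes d) <= size (nodes b).
  rewrite -(leq_add2l (size (nodes c))); apply: leq_trans le _.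
  by rewrite leq_add2r.
by rewrite (IHa _ p1 ca) (IHb _ p2 db).
Qed.

Section RepIso.
Variables V1 V2 : finType.
Variables (T1 : tree V1) (T2 : tree V2) (g1 : gtree V1) (g2 : gtree V2).
Hypotheses (r1 : rep T1 (rt T1) g1) (r2 : rep T2 (rt T2) g2)
  (n1 : uniq (nodes g1)) (n2 : uniq (nodes g2)).

Lemma hom_pre f : is_hom T1 T2 f -> pre (gmap f g1) g2.
Proof.
case=> -[_ _ hr] hs hd.
have sub : {subset nodes g1 <= verts T1} by move=> x; rewrite (rep_verts r1).
elim: g1 (g2) (rt T1) (rt T2) r1 r2 hr sub => //= v a IHa b IHb [|w c d] o1 o2 /=.
  by move=> [-> _ _] -> /(_ _ erefl).
move=> [-> ra rb] [-> rc rd] /(_ _ erefl) [wE] sub; subst w; rewrite eqxx /=.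
have vv : v \in verts T1 by apply: sub; rewrite inE eqxx.
apply/andP; split.
  apply: (IHa _ _ _ ra rc) => [y|x xa]; first exact: (hs v vv y).
  by apply: sub; rewrite inE mem_cat xa orbT.
apply: (IHb _ _ _ rb rd) => [y|x xb]; first exact: (hd v vv y).
by apply: sub; rewrite inE mem_cat xb !orbT.
Qed.

(** A homomorphism copies [g1] onto an initial part of [g2] ([hom_pre]). Surjectivity bounds the
    size of [g2], so this part is all of [g2]. *)
Lemma rep_iso f : is_iso T1 T2 f <-> gmap f g1 = g2.
Proof.
split=> [[hom onto]|e].
  apply: pre_eq (hom_pre hom) _.
  rewrite nodes_gmap size_map -(rep_card r1 n1) -(rep_card r2 n2) -onto.
  exact: leq_imset_card.
have ne : map f (nodes g1) = nodes g2 by rewrite -nodes_gmap e.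
have onto : f @: verts T1 = verts T2.
  apply/setP=> y; rewrite (rep_verts r2) -ne; apply/imsetP/mapP=> -[x xv ->]; exists x => //.
    by rewrite -(rep_verts r1).
  by rewrite (rep_verts r1).
have struct : forall x, x \in nodes g1 ->
    (forall y, son T1 x = Some y -> son T2 (f x) = Some (f y)) /\
    (forall y, dau T1 x = Some y -> dau T2 (f x) = Some (f y)).
  have r2' : rep T2 (rt T2) (gmap f g1) by rewrite e.
  elim: g1 (rt T1) (rt T2) r1 r2' => //= v a IHa b IHb o1 o2 [_ ra rb] [_ ra' rb'] x.
  rewrite inE mem_cat => /or3P[/eqP->|/(IHa _ _ ra ra')//|/(IHb _ _ rb rb')//].
  split=> y h.
    by case: a ra ra' {IHa} => [|? ? ?] /=; rewrite h // => -[[<-] _ _] [].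
  by case: b rb rb' {IHb} => [|? ? ?] /=; rewrite h // => -[[<-] _ _] [].
split=> //; split.
- split.
  + by move=> x xv; rewrite -onto imset_f.
  + apply/imset_injP; rewrite onto (rep_card r2 n2) (rep_card r1 n1) -ne size_map.
    exact: eqxx.
  + move=> r hr; move: r1 r2; rewrite hr -e; case: g1 => [|v a b] //= [[->] _ _] [->].
    by [].
- by move=> x; rewrite (rep_verts r1) => /struct[].
- by move=> x; rewrite (rep_verts r1) => /struct[].
Qed.

Lemma rep_isomorphic (v2 : V2) : isomorphic T1 T2 <-> gshape g1 = gshape g2.
Proof.
split=> [[f /rep_iso<-]|e]; first by rewrite gshape_gmap.
exists (fun x => nth v2 (nodes g2) (index x (nodes g1))).
apply/rep_iso/gmap_of_shape => //; apply: map_nth_index => //.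
exact: gsize_shape.
Qed.

Lemma anti_swap f : is_anti_iso T1 T2 f <-> is_iso T1 (swap T2) f.
Proof.
rewrite /is_iso /is_hom /inj_rooted verts_swap /=; split.
  by case=> -[h1 h2 h3] h4 h5 h6; split.
by case=> -[[h1 h2 h3] h5 h6] h4; split.
Qed.

End RepIso.

Section RepAnti.
Variables V1 V2 : finType.
Variables (T1 : tree V1) (T2 : tree V2) (g1 : gtree V1) (g2 : gtree V2).
Hypotheses (r1 : rep T1 (rt T1) g1) (r2 : rep T2 (rt T2) g2)
  (n1 : uniq (nodes g1)) (n2 : uniq (nodes g2)).

Let n2' : uniq (nodes (gmirror g2)).
Proof. by rewrite (perm_uniq (nodes_mirror g2)). Qed.

Lemma rep_anti f : is_anti_iso T1 T2 f <-> gmap f g1 = gmirror g2.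
Proof.
have [h1 h2] := rep_iso r1 (rep_swap r2) n1 n2' f.
by split=> [/anti_swap/h1|/h2/anti_swap].
Qed.

Lemma rep_anti_isomorphic (v2 : V2) :
  anti_isomorphic T1 T2 <-> gshape g1 = gmirror (gshape g2).
Proof.
rewrite /gshape -gmap_mirror.
have [h1 h2] := rep_isomorphic r1 (rep_swap r2) n1 n2' v2.
split=> [[f /anti_swap hf]|/h2[f hf]]; first by apply: h1; exists f.
by exists f; apply/anti_swap.
Qed.

End RepAnti.

(** Restores the inner vertices, which a leaf-labelled tree leaves implicit. *)
Fixpoint fulltree (u : btree unit) : gtree unit :=
  match u with
  | Lf _ => Gn tt Ge Ge
  | Nd a b => Gn tt (fulltree a) (fulltree b)
  end.

Lemma fulltree_inj : injective fulltree.
Proof.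
have ne u : fulltree u <> Ge by case: u.
elim=> [[]|a IHa b IHb] [[]|c d] //= [].
- by move=> /esym/ne.
- by move=> /ne.
by move=> /IHa-> /IHb->.
Qed.

Lemma fulltree_mirror u : fulltree (mirror u) = gmirror (fulltree u).
Proof. by elim: u => //= a -> b ->. Qed.

(** * The skeleton *)

Section Spine.
Variables (n : nat) (T : tree 'I_n.+1).
Local Notation point := 'I_n.+1.
Hypothesis hT : order_preserving T.
Implicit Types (x y m : point) (us : seq (entry n)).

(** The bounds on the vertices are carried along to separate the two halves, which makes all
    vertices distinct. *)
Lemma inner_rep x y u : gap_tree T x y u -> x < y -> exists g,
  [/\ rep (inner T) (Some (x, y)) g, uniq (nodes g), gshape g = fulltree (shape u)
    & forall p, p \in nodes g -> [/\ x <= p.1, p.1 < p.2 & p.2 <= y]].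
Proof.
elim: u x y => [a|u1 IH1 u2 IH2] x y /=.
  move=> [_ h] xy; exists (Gn (x, y) Ge Ge); split=> //=.
    by rewrite -/(gap x y) h.
  by move=> p; rewrite inE => /eqP->.
move=> [m [hm h1 h2]] xy; have [] := highestP hm; rewrite inE => /andP[xm my] _.
have [g1 [r1 n1 s1 i1]] := IH1 _ _ h1 xm.
have [g2 [r2 n2 s2 i2]] := IH2 _ _ h2 my.
exists (Gn (x, y) g1 g2); split=> /=.
- by rewrite -/(gap x y) hm.
- rewrite mem_cat cat_uniq n1 n2 andbT negb_or; apply/and3P; split.
  + apply/andP; split; apply/negP.
      by move=> /i1[_ _] /=; rewrite leqNgt my.
    by move=> /i2[] /=; rewrite leqNgt xm.
  + by [].
  apply/hasPn=> p /i2[mp pp _]; apply/negP=> /i1[_ _ pm].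
  by have := leq_ltn_trans mp (leq_trans pp pm); rewrite ltnn.
- by rewrite /gshape /= -/(gshape g1) -/(gshape g2) s1 s2.
move=> p; rewrite inE mem_cat => /or3P[/eqP->|/i1[h3 h4 h5]|/i2[h3 h4 h5]] //=.
  by split=> //; apply: leq_trans h5 (ltnW my).
by split=> //; apply: leq_trans (ltnW xm) h3.
Qed.

Definition inner_shaped (e : entry n) := exists g, [/\ rep (inner_at T e.1) (rt (inner_at T e.1)) g,
  uniq (nodes g) & gshape g = fulltree (shape e.2)].

Fixpoint all_inner_shaped us : Prop := if us is e :: us' then inner_shaped e /\ all_inner_shaped us' else True.

Lemma rep_subtree (V : finType) (U : tree V) v o g : rep U o g -> rep (subtree_at U v) o g.
Proof. by elim: g o => //= w a IHa b IHb o [-> /IHa ? /IHb ?]. Qed.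

Lemma gap_tree_shaped x y m u : gap_tree T x y u -> x < y ->
  inner_at T m = subtree_at (inner T) (x, y) -> inner_shaped (m, u).
Proof.
move=> hu xy e; have [g [r un s _]] := inner_rep hu xy.
by exists g; rewrite /= e; split=> //; apply: rep_subtree.
Qed.

Lemma parentE p x : child T p x -> parent T x = Some p.
Proof.
move=> px; rewrite /parent; case: pickP => [q qx|/(_ p)]; last by rewrite px.
by rewrite (parent_uniq hT qx px).
Qed.

(** True at the root and, by [rspine_dau], at each further vertex on the path to [ord_max]. *)
Definition rspine x := forall y, x < y -> desceq T x y.
Definition lspine x := forall y, y < x -> desceq T x y.

Lemma rspine_dau x m : rspine x -> highest T (above x) = Some m ->
  dau T x = Some m /\ rspine m.
Proof.
move=> sx hm; have [mx top] := highestP hm; rewrite inE in mx; split; last first.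
  by move=> y my; apply: top; rewrite inE (ltn_trans mx my).
have [xm|[c ch cm]] := desc_child (sx _ mx); first by rewrite xm ltnn in mx.
case/child_cases: ch => h.
  by have := son_lt hT h cm; rewrite ltnNge (ltnW mx).
have xc := dau_gt hT h (desc_refl T c).
by rewrite h; congr Some; apply: (desc_anti hT cm); apply: top; rewrite inE.
Qed.

Lemma lspine_son x m : lspine x -> highest T (under x) = Some m ->
  son T x = Some m /\ lspine m.
Proof.
move=> sx hm; have [mx top] := highestP hm; rewrite inE in mx; split; last first.
  by move=> y my; apply: top; rewrite inE (ltn_trans my mx).
have [xm|[c ch cm]] := desc_child (sx _ mx); first by rewrite xm ltnn in mx.
case/child_cases: ch => h; last first.
  by have := dau_gt hT h cm; rewrite ltnNge (ltnW mx).
have xc := son_lt hT h (desc_refl T c).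
by rewrite h; congr Some; apply: (desc_anti hT cm); apply: top; rewrite inE.
Qed.

Lemma no_dau x : highest T (above x) = None -> dau T x = None.
Proof.
move=> /(highest_none hT (@above_convex _ x))/setP h; case E: (dau T x) => [c|] //.
by have := h c; rewrite !inE (dau_gt hT E (desc_refl T c)).
Qed.

Lemma no_son x : highest T (under x) = None -> son T x = None.
Proof.
move=> /(highest_none hT (@under_convex _ x))/setP h; case E: (son T x) => [c|] //.
by have := h c; rewrite !inE (son_lt hT E (desc_refl T c)).
Qed.

Lemma rspine_end m : rspine m -> desceq T m ord_max.
Proof.
move=> sm; have := leq_ord m; rewrite leq_eqVlt => /orP[/eqP e|]; last exact: (sm ord_max).
by rewrite (_ : m = ord_max) ?desc_refl //; apply: val_inj.
Qed.

Lemma lspine_end m : lspine m -> desceq T m ord0.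
Proof.
move=> sm; have := leq0n m; rewrite leq_eqVlt => /orP[/eqP e|]; last exact: (sm ord0).
by rewrite (_ : m = ord0) ?desc_refl //; apply: val_inj.
Qed.

Lemma rchain_inner_at x us : rchain T x us -> rspine x -> all_inner_shaped us.
Proof.
elim: us x => //= -[m u] us IH x [/= hm hu hus] sx.
have [dx sm] := rspine_dau sx hm; split; last exact: IH sm.
have [mx _] := highestP hm; rewrite inE in mx.
apply: (gap_tree_shaped hu mx); rewrite /inner_at (parentE (dau_child dx)) ltnNge (ltnW mx) /=.
rewrite /inner_l; case: eqP => [m0|_]; first by rewrite m0 in mx.
(* One unfolding of [cbounds_rec] suffices: the lower bound of a daughter is its parent. *)
rewrite /cbounds /= (parentE (dau_child dx)); case: eqP => // h.
by have := son_lt hT h (desc_refl T m); rewrite ltnNge (ltnW mx).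
Qed.

Lemma lchain_inner_at x us : lchain T x us -> lspine x -> all_inner_shaped us.
Proof.
elim: us x => //= -[m u] us IH x [/= hm hu hus] sx.
have [dx sm] := lspine_son sx hm; split; last exact: IH sm.
have [mx _] := highestP hm; rewrite inE in mx.
apply: (gap_tree_shaped hu mx); rewrite /inner_at (parentE (son_child dx)) mx.
rewrite /inner_r; case: eqP => [m0|_]; first by have := leq_trans mx (leq_ord x); rewrite m0 ltnn.
by rewrite /cbounds /= (parentE (son_child dx)) dx eqxx.
Qed.

Fixpoint rcomb (s : seq point) : gtree point :=
  if s is m :: s' then Gn m Ge (rcomb s') else Ge.

Fixpoint lcomb (s : seq point) : gtree point :=
  if s is m :: s' then Gn m (lcomb s') Ge else Ge.

Lemma nodes_rcomb s : nodes (rcomb s) = s.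
Proof. by elim: s => //= m s ->. Qed.

Lemma nodes_lcomb s : nodes (lcomb s) = s.
Proof. by elim: s => //= m s ->; rewrite cats0. Qed.

(** The son of a vertex strictly below [x] on the right spine lies strictly between [x] and that
    vertex, so no end of the chain is below it and the skeleton has only daughters there. *)
Lemma rchain_skeleton x us : rchain T x us -> rspine x ->
  rep (skeleton T) (dau (skeleton T) x) (rcomb (map fst us)).
Proof.
elim: us x => [|[m u] us IH] x /=; first by move=> /no_dau->.
move=> [/= hm _ hus] sx; have [dx sm] := rspine_dau sx hm; split.
- by rewrite dx !inE (rspine_end sm) orbT.
- case E: (son T m) => [s|] //; rewrite !inE.
  case: ifP => // /orP[] h; last first.
    by have := son_lt hT E h; rewrite ltnNge leq_ord.
  have := dau_gt hT dx (desc_trans (desc1 (son_child E)) h).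
  by rewrite ltn0.
exact: IH.
Qed.

Lemma lchain_skeleton x us : lchain T x us -> lspine x ->
  rep (skeleton T) (son (skeleton T) x) (lcomb (map fst us)).
Proof.
elim: us x => [|[m u] us IH] x /=; first by move=> /no_son->.
move=> [/= hm _ hus] sx; have [dx sm] := lspine_son sx hm; split.
- by rewrite dx !inE (lspine_end sm).
- exact: IH.
case E: (dau T m) => [s|] //; rewrite !inE.
case: ifP => // /orP[] h.
  by have := dau_gt hT E h; rewrite ltn0.
have := son_lt hT dx (desc_trans (desc1 (dau_child E)) h).
by rewrite ltnNge leq_ord.
Qed.

Lemma rchain_mem x us : rchain T x us -> rspine x ->
  forall a, (a \in map fst us) = (a \in omega_ends T) && (x < a).
Proof.
elim: us x => [|[m u] us IH] x /=.
  move=> /(rchain_top hT) xn _ a; rewrite in_nil xn; apply/esym.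
  by rewrite ltnNge leq_ord andbF.
move=> [/= hm _ hus] sx a; have [dx sm] := rspine_dau sx hm.
have [mx top] := highestP hm; rewrite inE in mx.
rewrite inE (IH m) //; apply/orP/andP=> [[/eqP->|/andP[ao ma]]|[ao xa]].
- by rewrite !inE (rspine_end sm) orbT.
- by rewrite ao (ltn_trans mx ma).
have ma : desceq T m a by apply: top; rewrite inE.
have am : desceq T a ord_max.
  move: ao; rewrite !inE => /orP[h|//].
  by have := dau_gt hT dx (desc_trans ma h); rewrite ltn0.
have [->|[c ch ca]] := desc_child ma; first by left.
right; rewrite ao /=; case/child_cases: ch => h; last exact: (dau_gt hT h ca).
by have := son_lt hT h (desc_trans ca am); rewrite ltnNge leq_ord.
Qed.

Lemma lchain_mem x us : lchain T x us -> lspine x ->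
  forall a, (a \in map fst us) = (a \in omega_ends T) && (a < x).
Proof.
elim: us x => [|[m u] us IH] x /=.
  by move=> /(lchain_bot hT) xn _ a; rewrite in_nil xn ltn0 andbF.
move=> [/= hm _ hus] sx a; have [dx sm] := lspine_son sx hm.
have [mx top] := highestP hm; rewrite inE in mx.
rewrite inE (IH m) //; apply/orP/andP=> [[/eqP->|/andP[ao ma]]|[ao xa]].
- by rewrite !inE (lspine_end sm).
- by rewrite ao (ltn_trans ma mx).
have ma : desceq T m a by apply: top; rewrite inE.
have am : desceq T a ord0.
  move: ao; rewrite !inE => /orP[//|h].
  by have := son_lt hT dx (desc_trans ma h); rewrite ltnNge leq_ord.
have [->|[c ch ca]] := desc_child ma; first by left.
right; rewrite ao /=; case/child_cases: ch => h; first exact: (son_lt hT h ca).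
by have := dau_gt hT h (desc_trans ca am); rewrite ltn0.
Qed.

Lemma rchain_uniq x us : rchain T x us -> rspine x -> uniq (map fst us).
Proof.
elim: us x => //= -[m u] us IH x [/= hm _ hus] sx.
have [dx sm] := rspine_dau sx hm.
by rewrite (rchain_mem hus sm) ltnn andbF (IH m).
Qed.

Lemma lchain_uniq x us : lchain T x us -> lspine x -> uniq (map fst us).
Proof.
elim: us x => //= -[m u] us IH x [/= hm _ hus] sx.
have [dx sm] := lspine_son sx hm.
by rewrite (lchain_mem hus sm) ltnn andbF (IH m).
Qed.

Definition skel r (ls rs : seq (entry n)) :=
  Gn r (lcomb (map fst ls)) (rcomb (map fst rs)).

Lemma root_spine r : rt T = Some r -> lspine r /\ rspine r.
Proof.
by move=> hr; have [r' []] := root_ex hT; rewrite hr => -[<-] top; split=> y _.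
Qed.

Lemma skel_rep r ls rs : rt T = Some r -> lchain T r ls -> rchain T r rs ->
  rep (skeleton T) (rt (skeleton T)) (skel r ls rs) /\ uniq (nodes (skel r ls rs)).
Proof.
move=> hr hl hrs; have [sl sr] := root_spine hr; split.
  by split; [|apply: lchain_skeleton|apply: rchain_skeleton].
rewrite /= nodes_lcomb nodes_rcomb cat_uniq (lchain_uniq hl sl) (rchain_uniq hrs sr).
rewrite mem_cat (lchain_mem hl sl) (rchain_mem hrs sr) ltnn andbF /= andbT.
apply/hasPn=> a; rewrite (rchain_mem hrs sr) /= (lchain_mem hl sl) => /andP[_ ra].
by rewrite ltnNge (ltnW ra) andbF.
Qed.

End Spine.

(** * From chains back to skeletons and inner trees *)

Lemma all_inner_iso (n : nat) (T1 T2 : tree 'I_n.+1) us vs (eta : 'I_n.+1 -> 'I_n.+1) :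
  all_inner_shaped T1 us -> all_inner_shaped T2 vs -> map eta (map fst us) = map fst vs ->
  (forall a, a \in map fst us -> isomorphic (inner_at T1 a) (inner_at T2 (eta a))) <->
  map (@shape _) (map snd vs) = map (@shape _) (map snd us).
Proof.
elim: us vs => [|[a u] us IH] [|[b v] vs] //= [[g [/= r un s]] gu] [[g' [/= r' un' s']] gv] [ab e].
have [h1 h2] := IH vs gu gv e.
have iso : isomorphic (inner_at T1 a) (inner_at T2 b) <-> shape v = shape u.
  have [i1 i2] := rep_isomorphic r r' un un' (ord0, ord0).
  split=> [/i1|E]; first by rewrite s s' => /fulltree_inj.
  by apply: i2; rewrite s s' E.
split=> [h|[E1 E2] c].
  congr cons; first by apply/iso; rewrite -ab; apply: h; rewrite inE eqxx.
  by apply: h1 => c cu; apply: h; rewrite inE cu orbT.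
by rewrite inE => /orP[/eqP->|cu]; [rewrite ab; apply/iso|apply: h2].
Qed.

Lemma all_inner_anti (n : nat) (T1 T2 : tree 'I_n.+1) us vs (eta : 'I_n.+1 -> 'I_n.+1) :
  all_inner_shaped T1 us -> all_inner_shaped T2 vs -> map eta (map fst us) = map fst vs ->
  (forall a, a \in map fst us -> anti_isomorphic (inner_at T1 a) (inner_at T2 (eta a))) <->
  map (@shape _) (map snd vs) = map (@mirror unit) (map (@shape _) (map snd us)).
Proof.
elim: us vs => [|[a u] us IH] [|[b v] vs] //= [[g [/= r un s]] gu] [[g' [/= r' un' s']] gv] [ab e].
have [h1 h2] := IH vs gu gv e.
have iso : anti_isomorphic (inner_at T1 a) (inner_at T2 b) <-> shape v = mirror (shape u).
  have [i1 i2] := rep_anti_isomorphic r r' un un' (ord0, ord0).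
  rewrite s s' -fulltree_mirror in i1 i2; split=> [/i1/fulltree_inj->|E].
    by rewrite mirrorK.
  by apply: i2; rewrite E mirrorK.
split=> [h|[E1 E2] c].
  congr cons; first by apply/iso; rewrite -ab; apply: h; rewrite inE eqxx.
  by apply: h1 => c cu; apply: h; rewrite inE cu orbT.
by rewrite inE => /orP[/eqP->|cu]; [rewrite ab; apply/iso|apply: h2].
Qed.

Lemma chain_labels (n : nat) (T : tree 'I_n.+1) r ls rs : order_preserving T ->
  lchain T r ls -> rchain T r rs ->
  uniq (labels (map snd ls) ++ labels (map snd rs)) /\
  labels (map snd ls) ++ labels (map snd rs) =i cells n.
Proof.
move=> hT /(lchain_labels hT)[nl el] /(rchain_labels hT)[nr er].
split=> [|c].
  rewrite cat_uniq nl nr andbT /=; apply/hasPn=> c.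
  by rewrite er /= el !inE => /andP[rc _]; rewrite -leqNgt.
rewrite mem_cat el er !inE; case: ltnP => //= cr.
by rewrite (leq_trans cr) // -ltnS.
Qed.

Lemma linked_transports (n : nat) us vs us' vs' (f : 'I_n.+1 -> 'I_n.+1) :
  labels us ++ labels vs =i cells n -> labels us' ++ labels vs' =i cells n ->
  transports (cells n) (whit us vs) (whit us' vs') f <->
  [/\ injective f, linked f us vs us' vs'
   & forall x, (f x \in labels us' ++ labels vs') = (x \in labels us ++ labels vs)].
Proof.
move=> e e'.
have sub (S : {set 'I_n.+1}) : reflect {subset S <= labels us ++ labels vs} (S \subset cells n).
  by apply: (iffP subsetP) => h x /h; rewrite e.
split=> [[fI fD fw]|[fI fw fD]]; split=> //.
- by move=> S c d /sub SD cS; apply: fw.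
- by move=> x; rewrite e e' fD.
- by move=> x; rewrite -e' -e fD.
by move=> S c d /sub SD cS; apply: fw.
Qed.

Theorem theorem6p20 (n : nat)
    (R R' : {set {ffun 'I_n.+1 -> 'I_n.+1}})
    (T1 T2 : tree 'I_n.+1) (r1 : 'I_n.+1)
    (hR : R_cross_section R) (hR' : R_cross_section R')
    (hT1 : decreasing T1) (hT2 : decreasing T2)
    (hr1 : rt T1 = Some r1)
    (hRT1 : forall phi, phi \in R <-> Phi T1 phi)
    (hRT2 : forall phi, phi \in R' <-> Phi T2 phi) :
  semigroup_isomorphic R R' <->
  exists eta : 'I_n.+1 -> 'I_n.+1,
    [/\ is_iso (skeleton T1) (skeleton T2) eta \/
        is_anti_iso (skeleton T1) (skeleton T2) eta,
        (forall a, a \in omega_ends T1 -> r1 < a ->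
           isomorphic (inner_at T1 a) (inner_at T2 (eta a))) \/
        (forall a, a \in omega_ends T1 -> r1 < a ->
           anti_isomorphic (inner_at T1 a) (inner_at T2 (eta a)))
      & (forall a, a \in omega_ends T1 -> a < r1 ->
           isomorphic (inner_at T1 a) (inner_at T2 (eta a))) \/
        (forall a, a \in omega_ends T1 -> a < r1 ->
           anti_isomorphic (inner_at T1 a) (inner_at T2 (eta a)))].
Proof.
have {hT1}[hT1 _] := hT1; have {hT2}[hT2 _] := hT2.
have [r2 [hr2 _]] := root_ex hT2.
have [[ls1 hl1] [rs1 hs1]] := (lchain_ex T1 r1, rchain_ex T1 r1).
have [[ls2 hl2] [rs2 hs2]] := (lchain_ex T2 r2, rchain_ex T2 r2).
have M1 := cross_model hT1 hR hRT1 hr1 hl1 hs1.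
have M2 := cross_model hT2 hR' hRT2 hr2 hl2 hs2.
have [[u1 e1] [u2 e2]] := (chain_labels hT1 hl1 hs1, chain_labels hT2 hl2 hs2).
have [[sl1 sr1] [sl2 sr2]] := (root_spine hT1 hr1, root_spine hT2 hr2).
have [[k1 kn1] [k2 kn2]] := (skel_rep hT1 hr1 hl1 hs1, skel_rep hT2 hr2 hl2 hs2).
have [gl1 gr1] := (lchain_inner_at hT1 hl1 sl1, rchain_inner_at hT1 hs1 sr1).
have [gl2 gr2] := (lchain_inner_at hT2 hl2 sl2, rchain_inner_at hT2 hs2 sr2).
(* For the vertices on one side of the root, clause (i) or (ii) says exactly that the corresponding
   chains are [alike]. *)
have alikeP us vs eta (side : pred 'I_n.+1) :
    (forall a, (a \in map fst us) = (a \in omega_ends T1) && side a) ->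
    all_inner_shaped T1 us -> all_inner_shaped T2 vs -> map eta (map fst us) = map fst vs ->
    alike (map snd us) (map snd vs) <->
    (forall a, a \in omega_ends T1 -> side a ->
       isomorphic (inner_at T1 a) (inner_at T2 (eta a))) \/
    (forall a, a \in omega_ends T1 -> side a ->
       anti_isomorphic (inner_at T1 a) (inner_at T2 (eta a))).
  move=> mem g1 g2 e.
  have [[i1 i2] [j1 j2]] := (all_inner_iso g1 g2 e, all_inner_anti g1 g2 e).
  split=> -[h|h].
  - by left=> a ao sa; apply: (i2 h); rewrite mem ao.
  - by right=> a ao sa; apply: (j2 h); rewrite mem ao.
  - by left; apply: i1 => a; rewrite mem => /andP[]; apply: h.
  by right; apply: j1 => a; rewrite mem => /andP[]; apply: h.
have [meml memr] := (lchain_mem hT1 hl1 sl1, rchain_mem hT1 hs1 sr1).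
have alike_len (us vs : seq (entry n)) : alike (map snd us) (map snd vs) -> size us = size vs.
  by case=> /(congr1 size); rewrite !size_map.
pose s1 := r1 :: map fst ls1 ++ map fst rs1.
have us1 : uniq s1 by have := kn1; rewrite /= nodes_lcomb nodes_rcomb.
(* A map with prescribed values on the vertices of the skeleton, listed without repetition in [s1].
   Elsewhere its value is the default [r2]. *)
have label_map (as1 bs1 : seq 'I_n.+1) : size (map fst ls1) = size as1 ->
    size (map fst rs1) = size bs1 -> exists eta : 'I_n.+1 -> 'I_n.+1,
    [/\ eta r1 = r2, map eta (map fst ls1) = as1 & map eta (map fst rs1) = bs1].
  move=> za zb; exists (fun x => nth r2 (r2 :: as1 ++ bs1) (index x s1)).
  have := @map_nth_index _ _ r2 s1 (r2 :: as1 ++ bs1) us1.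
  rewrite /s1 /= !size_cat za zb => /(_ erefl) [h].
  rewrite map_cat => /eqP; rewrite eqseq_cat; last by rewrite size_map.
  case/andP=> /eqP ha /eqP hb.
  by rewrite eqxx.
have gmap_l (h : 'I_n.+1 -> 'I_n.+1) s : gmap h (lcomb s) = lcomb (map h s).
  by elim: s => //= x s ->.
have gmap_r (h : 'I_n.+1 -> 'I_n.+1) s : gmap h (rcomb s) = rcomb (map h s).
  by elim: s => //= x s ->.
have mir_l (s : seq 'I_n.+1) : gmirror (lcomb s) = rcomb s by elim: s => //= x s ->.
have mir_r (s : seq 'I_n.+1) : gmirror (rcomb s) = lcomb s by elim: s => //= x s ->.
split=> [/(iso_transports M1 M2)[f /(linked_transports f e1 e2)[fI lf fD]]|[eta [sk cr cl]]].
  have [g fK gK] := injF_bij fI.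
  have fill us vs R0 j : model (cells n) R0 j (whit us vs) ->
      labels us ++ labels vs =i cells n -> wfills us vs.
    move=> M e S c Ss; apply: (mod_hit M); apply/subsetP=> x /Ss; by rewrite e.
  have := linked_alike fK gK u1 u2 (fill _ _ _ _ _ M1 e1) (fill _ _ _ _ _ M2 e2) lf fD.
  case=> -[ar al].
    have [||eta [er el es]] := label_map (map fst ls2) (map fst rs2).
    - by rewrite !size_map (alike_len _ _ al).
    - by rewrite !size_map (alike_len _ _ ar).
    exists eta; split.
    + by left; apply/(rep_iso k1 k2 kn1 kn2); rewrite /= er gmap_l gmap_r el es.
    + by apply/(alikeP _ _ eta _ memr gr1 gr2 es).
    by apply/(alikeP _ _ eta _ meml gl1 gl2 el).
  (* The spines are exchanged, so [eta] sends left to right and inverts the genders. *)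
  have [||eta [er el es]] := label_map (map fst rs2) (map fst ls2).
  - by rewrite !size_map (alike_len _ _ al).
  - by rewrite !size_map (alike_len _ _ ar).
  exists eta; split.
  + by right; apply/(rep_anti k1 k2 kn1 kn2); rewrite /= er gmap_l gmap_r el es mir_l mir_r.
  + by apply/(alikeP _ _ eta _ memr gr1 gl2 es).
  by apply/(alikeP _ _ eta _ meml gl1 gr2 el).
have lcomb_inj : injective (@lcomb n) by move=> s t /(congr1 (@nodes _)); rewrite !nodes_lcomb.
have rcomb_inj : injective (@rcomb n) by move=> s t /(congr1 (@nodes _)); rewrite !nodes_rcomb.
case: sk => [/(rep_iso k1 k2 kn1 kn2)|/(rep_anti k1 k2 kn1 kn2)] /=.
  rewrite gmap_l gmap_r => -[_ /lcomb_inj el /rcomb_inj er].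
  have al := proj2 (alikeP _ _ eta _ meml gl1 gl2 el) cl.
  have ar := proj2 (alikeP _ _ eta _ memr gr1 gr2 er) cr.
  have [|f [g [fK gK fD lf]]] := alike_linked u1 u2 _ al ar; first by move=> x; rewrite e1 e2.
  apply: (transports_iso M1 M2); apply/(linked_transports f e1 e2).
  by split=> //; apply: can_inj fK.
(* For an anti-isomorphism the target spines are taken in the opposite order, and [linkedCr]
   restores the order at the end. *)
rewrite gmap_l gmap_r mir_l mir_r => -[_ /lcomb_inj el /rcomb_inj er].
have al := proj2 (alikeP _ _ eta _ meml gl1 gr2 el) cl.
have ar := proj2 (alikeP _ _ eta _ memr gr1 gl2 er) cr.
rewrite uniq_catC in u2.
have [|f [g [fK gK fD lf]]] := alike_linked u1 u2 _ al ar; first by move=> x; rewrite e1 mem_catC e2.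
apply: (transports_iso M1 M2); apply/(linked_transports f e1 e2).
split=> //; [exact: can_inj fK|exact: linkedCr|].
by move=> x; rewrite mem_catC fD.
Qed.
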